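(* There is a polynomial $p$ (independent of all data below) such that the following holds. Let $n \ge 1$, let $f \in \mathbb{Q}[x_1,\dots,x_n]$ be a convex polynomial, and let $P = \{x \in \mathbb{R}^n : Ax \le b\}$ be a nonempty convex polyhedron with $A \in \mathbb{Q}^{m\times n}$, $b \in \mathbb{Q}^m$. Then either $f$ is unbounded from below on $P$, or $f$ attains its minimum on $P$ at some point $x^* \in P$ with \[ \log \|x^*\| \le p(\langle f\rangle, \langle P\rangle). \]
   Context: The bit length $\mathrm{bl}(k)$ of an integer $k$ is $\max\{1,\lceil \log_2|k|\rceil\}$; the bit length of a reduced fraction $r=p/q$ is $\mathrm{bl}(p)+\mathrm{bl}(q)$; the bit length of a rational vector or matrix is the sum of the bit lengths of its entries; the bit length of $f=\sum_\alpha f_\alpha x^\alpha\in\mathbb{Q}[x]$ is the sum of the bit lengths of its nonzero coefficients. The encoding length of $f$ is $\langle f\rangle = n + \deg(f) + \sum_{\alpha: f_\alpha\neq 0}\mathrm{bl}(f_\alpha)$ (coefficients in binary, exponents in unary). The encoding length of $P=\{Ax\le b\}$ is $\langle P\rangle = \mathrm{bl}(A)+\mathrm{bl}(b)$, with the convention $\langle P\rangle \ge n$ when $P=\mathbb{R}^n$. $\|\cdot\|$ is the Euclidean norm. *)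

(* Defs.v *)
From HB Require Import structures.
From mathcomp Require Import all_boot all_order all_algebra.
From mathcomp Require Import mpoly.
From mathcomp Require Import Rstruct.
From Stdlib Require Import Rdefinitions.
From Stdlib Require Rpower.
Set Implicit Arguments. Unset Strict Implicit. Unset Printing Implicit Defensive.
Import Order.TTheory GRing.Theory Num.Theory.

Definition bl_int (k : int) : nat := maxn 1 (up_log 2 `|k|%N).

(* bit length of a rational (rat is stored in reduced form) *)
Definition bl_rat (r : rat) : nat := (bl_int (numq r) + bl_int (denq r))%N.

Definition bl_mx (m n : nat) (A : 'M[rat]_(m, n)) : nat :=
  (\sum_(i < m) \sum_(j < n) bl_rat (A i j))%N.

(* total degree of a multivariate polynomial (0 for the zero polynomial) *)
Definition mpoly_deg (n : nat) (f : {mpoly rat[n]}) : nat := (msize f).-1.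

Definition enc_poly (n : nat) (f : {mpoly rat[n]}) : nat :=
  (n + mpoly_deg f + \sum_(m <- msupp f) bl_rat f@_m)%N.

(* encoding length <P> = bl(A) + bl(b), with the convention <P> >= n when P = R^n.
   Since bl(A) >= m*n >= n whenever m >= 1, taking maxn with n only matters when
   m = 0 (the description of R^n by no inequalities). *)
Definition enc_poly_hedron (m n : nat) (A : 'M[rat]_(m, n)) (b : 'cV[rat]_m) : nat :=
  maxn n (bl_mx A + bl_mx b)%N.

Local Open Scope ring_scope.

Definition feval (n : nat) (f : {mpoly rat[n]}) (x : 'cV[R]_n) : R :=
  (map_mpoly (ratr : rat -> R) f).@[fun i => x i 0].

Definition convex_mpoly (n : nat) (f : {mpoly rat[n]}) : Prop :=
  forall (x y : 'cV[R]_n) (t : R), 0 <= t -> t <= 1 ->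
    feval f (t *: x + (1 - t) *: y) <= t * feval f x + (1 - t) * feval f y.

Definition in_polyhedron (m n : nat) (A : 'M[rat]_(m, n)) (b : 'cV[rat]_m)
  (x : 'cV[R]_n) : Prop :=
  forall i : 'I_m, (map_mx ratr A *m x) i 0 <= ratr (b i 0).

Definition eucl_norm (n : nat) (x : 'cV[R]_n) : R :=
  Num.sqrt (\sum_(i < n) (x i 0) ^+ 2).

Definition eval2 (p : {mpoly R[2]}) (a b : R) : R :=
  p.@[fun i : 'I_2 => if val i == 0%N then a else b].

(* natural logarithm on Stdlib reals (Rpower.ln; note ln 0 = 0 by convention there) *)
Definition Rln : R -> R := Rpower.ln.

(* Main.v *)
(** A univariate convex polynomial q of degree at most k satisfies
    q''(0) <= 2 k 2^k (q(1) - q(0) - q'(0)), so a convex f lies above its tangent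
    at z by at least a multiple 2^{-O(d)} of the quadratic form of its Hessian
    H(z).  If H(z) u = 0 for all z in the grid {0..N}^n, then H vanishes on u
    everywhere and f(x + u) = f(x) + c.u with c the gradient at 0.

    Suppose f is bounded below on P and let x be in P.  Then c.v >= 0 for every
    recession direction v of P with H(z) v = 0 on the grid, so pushing x towards a
    minimal face of {y in P | H(z) y = H(z) x for all grid points z} without
    increasing c.y, and solving by Cramer's rule, gives y in P with f(y) <= f(x)
    and |y| <= 2^poly (1 + W), where W is the largest entry of the H(z) x.  The
    quadratic lower bound at the grid point attaining W, together with the upper
    bound f(y) <= f(x0) for a small point x0 of P, forces W <= 2^poly.  Hence f may
    be minimised over P intersected with a box, which is compact.  With
    N = <f> + <P> + 10 the box has radius 2^(40 N^4). *)

Require Import Defs.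
From HB Require Import structures.
From mathcomp Require Import all_boot all_order all_algebra.
From mathcomp Require boolp functions classical_sets reals topology normedtype derive.
From Stdlib Require Classical_Prop Rpower.

Import Order.TTheory GRing.Theory Num.Theory.
Local Open Scope ring_scope.
Set Implicit Arguments.
Unset Strict Implicit.
Unset Printing Implicit Defensive.

(** * Attainment on bounded polyhedra *)

Module Attainment.
Import boolp functions classical_sets reals topology normedtype derive.
Import numFieldNormedType.Exports.
Local Open Scope classical_set_scope.

Section ContinuousAlgebra.
Variables (R : realType) (T : topologicalType).

Lemma continuous_sumr (I : Type) (s : seq I) (h : I -> T -> R) :
  (forall t, continuous (h t)) -> continuous (fun x => \sum_(t <- s) h t x).
Proof. by move=> ch x; apply: cvg_big => [|t _]; [exact: add_continuous|exact: ch]. Qed.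

Lemma continuous_prodr (I : Type) (s : seq I) (h : I -> T -> R) :
  (forall t, continuous (h t)) -> continuous (fun x => \prod_(t <- s) h t x).
Proof. by move=> ch x; apply: cvg_big => [|t _]; [exact: mul_continuous|exact: ch]. Qed.

Lemma continuous_mulr (h k : T -> R) :
  continuous h -> continuous k -> continuous (fun x => h x * k x).
Proof. by move=> ch ck x; apply: cvgM; [exact: ch|exact: ck]. Qed.

Lemma continuous_exprn (h : T -> R) (k : nat) :
  continuous h -> continuous (fun x => h x ^+ k).
Proof.
move=> ch; elim: k => [|k IH].
  by under eq_fun do rewrite expr0; exact: cst_continuous.
by under eq_fun do rewrite exprS; exact: continuous_mulr.
Qed.

End ContinuousAlgebra.

(** The objective is spelled out as a finite sum of monomials, so its continuity reduces to that of
    sums, products and powers of coordinates. The proof transposes to row vectors, the form required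
    by [rV_compact] and [EVT_min_rV]. *)
Lemma exists_min_on_box (R : realType) (n m : nat) (I : Type) (s : seq I)
    (a : I -> R) (e : I -> 'I_n -> nat) (A : 'M[R]_(m, n)) (b : 'cV[R]_m)
    (r : R) (g := fun x : 'cV[R]_n => \sum_(t <- s) a t * \prod_i x i 0 ^+ e t i)
    (P := fun x : 'cV[R]_n =>
       (forall i, (A *m x) i 0 <= b i 0) /\ (forall i, `|x i 0| <= r)) :
  (exists x, P x) -> exists2 x, P x & forall y, P y -> g x <= g y.
Proof.
move=> [x0 Px0].
have cp j : continuous (fun x : 'rV[R]_n => x 0 j) by move=> x; exact: coord_continuous.
have cg : continuous (fun x : 'rV[R]_n => g x^T).
  apply: continuous_sumr => t; apply: continuous_mulr; first exact: cst_continuous.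
  apply: continuous_prodr => i.
  under eq_fun do rewrite mxE.
  exact: continuous_exprn.
pose C := [set v : 'rV[R]_n | forall i, (A *m v^T) i 0 <= b i 0].
pose K := [set v : 'rV[R]_n | forall i, (`[- r, r]%classic) (v ord0 i)].
have cC : closed C.
  have -> : C = \bigcap_(i in setT) [set v : 'rV[R]_n | (A *m v^T) i 0 <= b i 0].
    by apply/seteqP; split => v /= Hv i; [move=> _; exact: Hv | exact: (Hv i Logic.I)].
  apply: closed_bigI => i _.
  apply: (@closed_comp _ _ (fun v : 'rV[R]_n => (A *m v^T) i 0) [set y | y <= b i 0]).
    move=> v _; move: v; under eq_fun do rewrite mxE.
    apply: continuous_sumr => j; apply: continuous_mulr; first exact: cst_continuous.
    by under eq_fun do rewrite mxE; exact: cp.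
  exact: closed_le.
have cK0 : compact K.
  apply: (@rV_compact R n (fun=> `[- r, r]%classic)) => i; exact: segment_compact.
have cK : compact (K `&` C).
  by apply: compact_closedI.
have inKC (y : 'cV[R]_n) : P y -> (K `&` C) y^T.
  move=> [Py1 Py2]; split => i /=; last by rewrite trmxK.
  by rewrite mxE in_itv /= -ler_norml.
have [||c cKC cmin] := @EVT_min_rV R n (fun x => g x^T) (K `&` C) _ cK.
- by exists x0^T; exact: inKC.
- exact: continuous_subspaceT.
exists c^T.
  move: cKC => /set_mem [cK1 cC1]; split => [|i]; first exact: cC1.
  by move: (cK1 i); rewrite /= in_itv /= mxE ler_norml.
by move=> y /inKC /mem_set /cmin; rewrite trmxK.
Qed.
End Attainment.

From mathcomp Require Import perm mpoly.
From mathcomp Require Import Rstruct.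
From mathcomp Require Import ring lra zify.

(** * Univariate convex polynomials *)

(** Substituting the monic linear polynomial ['X + h] keeps both the size and the leading
    coefficient, so the top terms cancel in the difference. *)
Lemma size_finite_difference (R : idomainType) (p : {poly R}) (h : R) (k : nat) :
  (size p <= k.+1)%N -> (size (p - (p \Po ('X + h%:P)))%R <= k)%N.
Proof.
move=> sp; have sq : size ('X + h%:P) = 2%N by rewrite size_XaddC.
have sc : size (p \Po ('X + h%:P)) = size p by rewrite size_comp_poly2.
apply/leq_sizeP => j; rewrite leq_eqVlt => /orP[/eqP <-|kj]. all: rewrite coefB.
  have [pk|pk] := leqP (size p) k.
    by rewrite !nth_default ?subr0 // sc.
  have e : size p = k.+1 by apply/eqP; rewrite eqn_leq sp.
  have lc : lead_coef (p \Po ('X + h%:P)) = lead_coef p.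
    by rewrite lead_coef_comp ?sq // lead_coefXaddC expr1n mulr1.
  by move: lc; rewrite !lead_coefE sc e /= => ->; rewrite subrr.
by rewrite !nth_default ?subr0 // ?sc (leq_trans sp).
Qed.

(** By Pascal's rule the difference of order [k.+1] of [p] is the difference of order [k] of
    [p(X) - p(X + h)], which has a smaller size bound, so induction applies. *)
Lemma sum_alternating_binomial (R : idomainType) (p : {poly R}) (h : R) (k : nat) :
  (size p <= k)%N ->
  \sum_(j < k.+1) (-1) ^+ j *+ 'C(k, j) * p.[j%:R * h] = 0.
Proof.
elim: k p => [|k IH] p sp.
  move: sp; rewrite leqn0 size_poly_eq0 => /eqP ->.
  by rewrite big1 // => j _; rewrite horner0 mulr0.
rewrite -[RHS](IH _ (size_finite_difference h sp)).
under [RHS]eq_bigr => j _ do rewrite hornerD hornerN horner_comp !hornerE mulrBr.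
rewrite sumrB big_ord_recl /= bin0.
under eq_bigr => j _ do rewrite binS mulrnDr mulrDl.
rewrite big_split /= addrA; congr (_ + _).
  rewrite [RHS]big_ord_recl bin0; congr (_ + _).
  rewrite big_ord_recr /= bin_small // mulr0n mul0r addr0.
  by apply: eq_bigr => j _.
rewrite -sumrN; apply: eq_bigr => j _.
rewrite /bump /= add1n exprS mulN1r mulNrn mulNr; congr (- (_ * _.[_])).
by rewrite -natr1 mulrDl mul1r.
Qed.

(** An algebraic substitute for continuity at 0, valid over any ordered field:
    [g(h) = g(0) + h w(h)] with [w] bounded on the unit disk. *)
Lemma poly_limit_le (R : realFieldType) (g : {poly R}) (c : R) :
  (forall h, 0 < h -> h <= 1 -> g.[h] <= c) -> g.[0] <= c.
Proof.
move=> gc; rewrite leNgt; apply/negP => lt_c.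
pose w := drop_poly 1 g.
have ge h : g.[h] = g.[0] + w.[h] * h.
  rewrite -(poly_take_drop 1 g) !hornerD !hornerM -/w hornerXn !hornerE expr1.
  by rewrite (size1_polyC (size_take_poly 1 g)) !hornerC.
have [b wb] := poly_disk_bound w 1.
have b0 : 0 <= b by apply: le_trans (wb 0 _); rewrite ?normr0.
pose e := g.[0] - c.
have e0 : 0 < e by rewrite subr_gt0.
(* With this choice [h * b < e], so [g(h) >= g(0) - h b > c]. *)
pose h := e / (e + b + 1).
have d0 : 0 < e + b + 1 by lra.
have h0 : 0 < h by rewrite divr_gt0.
have h1 : h <= 1 by rewrite ler_pdivrMr // mul1r; lra.
have := gc h h0 h1; rewrite ge => le_c.
have hn : `|h| <= 1 by rewrite ger0_norm // ltW.
have := wb h hn; rewrite ler_norml => /andP[wl _].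
have : h * (e + b + 1) = e by rewrite mulfVK // gt_eqF.
rewrite /e in e0 *; nra.
Qed.

(* With q = q0 + q1 X + X^2 s, convexity gives 0 <= s(t) <= s(1) / t on (0, 1], and
   the vanishing k-th difference expresses s(0) by the values s(j/k), j >= 1. *)
Lemma convex_poly_growth (R : realFieldType) (q : {poly R}) (k : nat) :
  (0 < k)%N -> (size q <= k.+1)%N ->
  (forall a t, 0 <= t -> t <= 1 -> q.[t * a] <= t * q.[a] + (1 - t) * q.[0]) ->
  0 <= q`_2 /\ q`_2 <= (k * 2 ^ k)%:R * (q.[1] - q.[0] - q`_1).
Proof.
move=> k0 sq conv; pose s := drop_poly 2 q.
have qE x : q.[x] = q`_0 + q`_1 * x + s.[x] * x ^+ 2.
  rewrite -{1}(poly_take_drop 2 q) hornerD hornerM hornerXn -/s; congr (_ + _).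
  rewrite (@horner_coef_wide _ 2) ?size_take_poly // !big_ord_recl big_ord0 /=.
  by rewrite !coef_take_poly /= expr0 mulr1 expr1 addr0.
have s1E : q.[1] - q.[0] - q`_1 = s.[1] by rewrite !qE; ring.
have s0E : q`_2 = s.[0] by rewrite horner_coef0 coef_drop_poly.
(* Convexity between 0 and [a], with the affine part of [q] cancelled and the rest divided by
   [h * a ^+ 2]. *)
have sh a h : a != 0 -> 0 < h -> h <= 1 -> h * s.[h * a] <= s.[a].
  move=> a0 h0 h1; have := conv a h (ltW h0) h1; rewrite !qE => H.
  have ha : 0 < h * a ^+ 2 by rewrite mulr_gt0 // exprn_even_gt0.
  rewrite -(ler_pM2l ha); lra.
have s_ge0 a : a != 0 -> 0 <= s.[a].
  (* Let [h] tend to 0 in [sh]: the left side [h * s(h a)] tends to 0. *)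
  move=> a0; have := @poly_limit_le _ ('X * (s \Po ('X * a%:P))) s.[a].
  rewrite !hornerE; apply => h h0 h1.
  by rewrite !hornerE horner_comp !hornerE; exact: sh.
split.
  rewrite s0E -oppr_le0 -hornerN; apply: poly_limit_le => h h0 _.
  by rewrite hornerN oppr_le0 s_ge0 // gt_eqF.
rewrite s1E s0E.
have kR : (0 : R) < k%:R by rewrite ltr0n.
have ss : (size s <= k)%N by rewrite size_drop_poly; lia.
have := sum_alternating_binomial k%:R^-1 ss.
rewrite big_ord_recl /= bin0 mul0r mul1r => /eqP; rewrite addr_eq0 => /eqP ->.
rewrite -sumrN natrM natrX.
(* Expanding [2 ^+ k] into binomial coefficients allows a termwise comparison. The term of index 0
   on the right is a nonnegative surplus. *)
have -> : k%:R * 2 ^+ k * s.[1] = \sum_(i < k.+1) 'C(k, i)%:R * (k%:R * s.[1]).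
  have -> : (2 ^+ k : R) = \sum_(i < k.+1) 'C(k, i)%:R.
    rewrite -natr_sum -natrX (expnDn 1 1); congr (_%:R).
    by apply: eq_bigr => i _; rewrite !exp1n !muln1.
  by rewrite -mulr_suml; ring.
rewrite [leRHS]big_ord_recl -[leLHS]add0r lerD //.
  by rewrite bin0 mul1r mulr_ge0 ?ler0n // s_ge0 // oner_eq0.
apply: ler_sum => j _; rewrite lift0.
have jR : (0 : R) < j.+1%:R by rewrite ltr0n.
have jk : j.+1%:R / k%:R <= 1 :> R by rewrite ler_pdivrMr // mul1r ler_nat.
have t0 : 0 < j.+1%:R / k%:R :> R by rewrite divr_gt0.
have sj := s_ge0 _ (lt0r_neq0 t0).
have sj1 : s.[j.+1%:R / k%:R] <= k%:R * s.[1].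
  have := sh 1 _ (oner_neq0 _) t0 jk; rewrite mulr1 => H.
  have : s.[j.+1%:R / k%:R] <= j.+1%:R * s.[j.+1%:R / k%:R].
    by rewrite ler_peMl // ler1n.
  move=> /le_trans; apply.
  by rewrite -ler_pdivrMl // mulrA [_^-1 * _]mulrC.
rewrite -[_ *+ 'C(_, _)]mulr_natl -mulrA -mulrN ler_wpM2l ?ler0n //.
apply: le_trans sj1; rewrite -[leRHS](ger0_norm sj) -mulNr.
apply: le_trans (ler_norm _) _; rewrite normrM normrN normrX normrN1 expr1n mul1r.
by rewrite lexx.
Qed.
(** * Restriction to lines and derivatives *)

Definition mev (R : comNzRingType) (n : nat) (p : {mpoly R[n]}) (x : 'cV[R]_n) : R :=
  p.@[fun i => x i 0].

Definition line_poly (R : comNzRingType) (n : nat) (p : {mpoly R[n]})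
    (x u : 'cV[R]_n) : {poly R} :=
  mmap (@polyC R) (fun i => (x i 0)%:P + (u i 0)%:P * 'X) p.

Section LinePoly.
Variables (R : comNzRingType) (n : nat).
Implicit Types (p q : {mpoly R[n]}) (x u : 'cV[R]_n).

Lemma horner_line_poly p x u t : (line_poly p x u).[t] = mev p (x + t *: u).
Proof.
rewrite /line_poly /mev /mmap mevalE horner_sum; apply: eq_bigr => m _.
rewrite hornerM hornerC /mmap1 horner_prod; congr (_ * _).
by apply: eq_bigr => i _; rewrite horner_exp !hornerE !mxE [t * _]mulrC.
Qed.

Lemma size_line_poly p x u : (size (line_poly p x u) <= msize p)%N.
Proof.
rewrite /line_poly /mmap big_seq.
apply: (big_ind (fun q : {poly R} => size q <= msize p)%N).
- by rewrite size_poly0.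
- move=> q1 q2 H1 H2; apply: leq_trans (size_polyD _ _) _.
  by rewrite geq_max H1.
move=> m /msize_mdeg_lt; apply: leq_trans.
rewrite mul_polyC; apply: leq_trans (size_scale_leq _ _) _.
rewrite mdegE /mmap1.
apply: (big_ind2 (fun (q : {poly R}) (k : nat) => size q <= k.+1)%N).
- by rewrite size_poly1.
- move=> q1 k1 q2 k2 H1 H2; apply: leq_trans (size_polyMleq _ _) _; lia.
move=> i _; apply: leq_trans (size_poly_exp_leq _ _) _.
rewrite ltnS -[X in (_ <= X)%N]mul1n leq_mul2r; apply/orP; right.
rewrite -subn1 leq_subLR addn1; apply: leq_trans (size_polyD _ _) _.
rewrite geq_max (leq_trans (size_polyC_leq1 _)) //=.
by rewrite mul_polyC; apply: leq_trans (size_scale_leq _ _) _; rewrite size_polyX.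
Qed.

(** The chain rule. The polynomials satisfying it contain the constants and the variables and are
    closed under sums and products (Leibniz's rule), hence are all polynomials. *)
Lemma deriv_line_poly p x u :
  (line_poly p x u)^`() = \sum_i u i 0 *: line_poly p^`M(i) x u.
Proof.
set h := fun i => (x i 0)%:P + (u i 0)%:P * 'X : {poly R}.
pose C p := (mmap (@polyC R) h p)^`() = \sum_i u i 0 *: mmap (@polyC R) h p^`M(i).
have C0 c : C c%:MP.
  by rewrite /C mmapC derivC big1 // => i _; rewrite mderivC mmap0 scaler0.
have CD q1 q2 : C q1 -> C q2 -> C (q1 + q2).
  rewrite /C => H1 H2; rewrite mmapD derivD H1 H2 -big_split /=.
  by apply: eq_bigr => i _; rewrite mderivD mmapD scalerDr.
have CM q1 q2 : C q1 -> C q2 -> C (q1 * q2).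
  rewrite /C => H1 H2; rewrite rmorphM derivM H1 H2 mulr_suml mulr_sumr -big_split /=.
  apply: eq_bigr => i _; rewrite mderivM rmorphD !rmorphM /= scalerDr.
  by rewrite scalerAl scalerAr.
have CX i : C 'X_i.
  rewrite /C mmapX mmap1U /h derivD !derivC add0r derivM derivC mul0r add0r derivX mulr1.
  rewrite (bigD1 i) //= big1 => [|j ji].
    rewrite mderivX mnm1E eqxx scale1r mmapX addr0.
    have -> : (U_(i) - U_(i))%MM = 0%MM :> 'X_{1..n} by apply/mnmP => j; rewrite mnmBE subnn mnm0E.
    by rewrite mmap11 -[1]/(1%:P) -mul_polyC mulr1.
  rewrite mderivX mnm1E eq_sym (negbTE ji) scale0r mmap0 scaler0 //.
have {CX} CXm m : C 'X_[m].
  rewrite mpolyXE_id; apply: (big_ind C) => // [|i _]; first exact: (C0 1).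
  elim: (m i) => [|k IH]; first by rewrite expr0; exact: (C0 1).
  by rewrite exprS; exact: CM.
change (C p); elim/mpolyind: p => [|c m q _ _ Cq]; first exact: (C0 0).
by apply: CD => //; rewrite -mul_mpolyC; exact: CM.
Qed.
End LinePoly.
(** The directional derivative is kept as a polynomial, so that it can be iterated and restricted to
    lines again. *)
Definition dir_mderiv (R : comNzRingType) (n : nat) (u : 'cV[R]_n)
    (p : {mpoly R[n]}) : {mpoly R[n]} := \sum_i u i 0 *: p^`M(i).

Definition gradient (R : comNzRingType) (n : nat) (p : {mpoly R[n]})
    (x : 'cV[R]_n) : 'rV[R]_n := \row_i mev p^`M(i) x.

Definition hessian (R : comNzRingType) (n : nat) (p : {mpoly R[n]})
    (x : 'cV[R]_n) : 'M[R]_n := \matrix_(i, j) mev p^`M(i)^`M(j) x.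

Section Derivatives.
Variables (R : comNzRingType) (n : nat).
Implicit Types (p q : {mpoly R[n]}) (x u : 'cV[R]_n).

Lemma mev_sumZ (I : Type) (s : seq I) (a : I -> R) (q : I -> {mpoly R[n]}) x :
  mev (\sum_(i <- s) a i *: q i) x = \sum_(i <- s) a i * mev (q i) x.
Proof.
by rewrite /mev raddf_sum /=; apply: eq_bigr => i _; rewrite mevalZ.
Qed.

Lemma deriv_line_poly_dir p x u :
  (line_poly p x u)^`() = line_poly (dir_mderiv u p) x u.
Proof.
rewrite deriv_line_poly /dir_mderiv /line_poly raddf_sum /=.
by apply: eq_bigr => i _; rewrite mmapZ /= mul_polyC.
Qed.

Lemma mev_dir_mderiv p x u : mev (dir_mderiv u p) x = (gradient p x *m u) 0 0.
Proof.
by rewrite mev_sumZ mxE; apply: eq_bigr => i _; rewrite mxE mulrC.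
Qed.

Lemma mderiv_dir_mderiv p u i :
  (dir_mderiv u p)^`M(i) = \sum_j u j 0 *: p^`M(i)^`M(j).
Proof.
rewrite /dir_mderiv raddf_sum /=; apply: eq_bigr => j _.
by rewrite mderivZ mderiv_comm.
Qed.

Lemma mev_mderiv_dir_mderiv p x u i :
  mev (dir_mderiv u p)^`M(i) x = (hessian p x *m u) i 0.
Proof.
rewrite mderiv_dir_mderiv mev_sumZ mxE; apply: eq_bigr => j _.
by rewrite mxE mulrC.
Qed.

Lemma mev_dir_mderiv2 p x u :
  mev (dir_mderiv u (dir_mderiv u p)) x = (u^T *m hessian p x *m u) 0 0.
Proof.
rewrite -mulmxA mev_sumZ mxE; apply: eq_bigr => i _.
by rewrite mev_mderiv_dir_mderiv [u^T 0 i]mxE.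
Qed.

Lemma hessian_sym p x : (hessian p x)^T = hessian p x.
Proof. by apply/matrixP => i j; rewrite !mxE mderiv_comm. Qed.

Lemma msize_mderiv p i : (msize p^`M(i) <= msize p)%N.
Proof.
rewrite /mderiv; apply: leq_trans (msize_sum _ _ _) _.
rewrite big_seq; apply: (big_ind (fun k => k <= msize p)%N) => //.
  by move=> a b Ha Hb; rewrite geq_max Ha.
move=> m /msize_mdeg_lt Hm; apply: leq_trans (msizeZ_le _ _) _.
by rewrite msizeX (leq_ltn_trans (mdegB _ _)).
Qed.

Lemma msize_dir_mderiv p u : (msize (dir_mderiv u p) <= msize p)%N.
Proof.
apply: leq_trans (msize_sum _ _ _) _.
apply: (big_ind (fun k => k <= msize p)%N) => //.
  by move=> a b Ha Hb; rewrite geq_max Ha.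
by move=> i _; apply: leq_trans (msizeZ_le _ _) (msize_mderiv _ _).
Qed.

End Derivatives.

(** * Multivariate polynomials over ordered fields: grids, affine directions, convexity *)

Section RealMpoly.
Variables (R : realFieldType) (n : nat).
Implicit Types (p : {mpoly R[n]}) (x y z u : 'cV[R]_n).

Lemma poly_eq0_nat_roots (q : {poly R}) (k : nat) :
  (size q <= k)%N -> (forall i, (i < k)%N -> q.[i%:R] = 0) -> q = 0.
Proof.
move=> sq q0; apply/eqP; apply: contraT => qn0.
pose rs := [seq i%:R : R | i <- iota 0 k].
have : (size rs < size q)%N.
  apply: max_poly_roots => //.
    by apply/allP => _ /mapP[i + ->]; rewrite mem_iota /root => /q0 ->.
  rewrite map_inj_uniq ?iota_uniq // => i j /eqP.
  by rewrite eqr_nat => /eqP.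
by rewrite size_map size_iota ltnNge sq.
Qed.

Lemma horner_eq_deriv0 (q : {poly R}) :
  (forall t, q^`().[t] = 0) -> forall s t, q.[s] = q.[t].
Proof.
move=> q'0; have d0 : q^`() = 0 by apply: (poly_eq0_nat_roots (leqnn _)).
have sq : (size q <= 1)%N.
  apply/leq_sizeP => -[|j] // _.
  have := congr1 (fun r : {poly R} => r`_j) d0; rewrite coef_deriv coef0 => /eqP.
  by rewrite mulrn_eq0 /= => /eqP.
by move=> s t; rewrite (size1_polyC sq) !hornerC.
Qed.

(** Coordinates are released from the grid one at a time: along a coordinate axis [p] restricts to a
    univariate polynomial of size at most [k.+1] with the [k.+1] roots 0, ..., [k]. *)
Lemma mev_eq0_on_grid p (k : nat) :
  (msize p <= k.+1)%N ->
  (forall g : {ffun 'I_n -> 'I_k.+1}, mev p (\col_i (g i)%:R) = 0) ->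
  forall x, mev p x = 0.
Proof.
move=> sp p0 x.
(* In [H j] the first [j] coordinates are arbitrary and the others still lie on the grid. *)
suff H j : (j <= n)%N -> forall x (g : {ffun 'I_n -> 'I_k.+1}),
    (forall i : 'I_n, (j <= i)%N -> x i 0 = (g i)%:R) -> mev p x = 0.
  by apply: (H n (leqnn _) x [ffun => ord0]) => i; rewrite leqNgt ltn_ord.
elim: j => [|j IH] jn {}x g xg.
  rewrite -[RHS](p0 g); congr (mev _ _); apply/colP => i.
  by rewrite mxE xg.
pose o := Ordinal jn.
pose y := \col_i (if i == o then 0 else x i 0) : 'cV[R]_n.
pose q := line_poly p y (delta_mx o 0).
have yt t : y + t *: delta_mx o 0 = \col_i (if i == o then t else x i 0).
  by apply/colP => i; rewrite !mxE eqxx andbT; case: (i == o); rewrite ?mulr1 ?add0r ?mulr0 ?addr0.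
have q0 : q = 0.
  apply: (@poly_eq0_nat_roots q k.+1).
    exact: leq_trans (size_line_poly _ _ _) sp.
  move=> a ak; rewrite horner_line_poly yt.
  apply: (IH (ltnW jn) _ [ffun i => if i == o then Ordinal ak else g i]) => i ji.
  rewrite mxE ffunE; case: eqP => // /eqP io; apply: xg.
  by rewrite ltn_neqAle ji andbT; move: io; apply: contra => /eqP e; apply/eqP/val_inj.
have := horner_line_poly p y (delta_mx o 0) (x o 0).
rewrite -/q q0 horner0 yt => ->; congr (mev _ _); apply/colP => i.
by rewrite mxE; case: eqP => // ->.
Qed.

(** The derivative of [p] along [u] has gradient [hessian p x *m u = 0], so it is a constant, read
    off at 0. Hence [p] has this constant slope on every line of direction [u]. *)
Lemma mev_affine_along p u :
  (forall x, hessian p x *m u = 0) ->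
  forall x, mev p (x + u) = mev p x + (gradient p 0 *m u) 0 0.
Proof.
move=> Hu x.
have gc y : mev (dir_mderiv u p) y = (gradient p 0 *m u) 0 0.
  rewrite -mev_dir_mderiv.
  have d t : (line_poly (dir_mderiv u p) 0 y)^`().[t] = 0.
    rewrite deriv_line_poly horner_sum big1 // => i _.
    by rewrite hornerZ horner_line_poly mev_mderiv_dir_mderiv Hu mxE mulr0.
  by have := horner_eq_deriv0 d 1 0; rewrite !horner_line_poly scale1r scale0r !add0r.
set c := (_ *m _) 0 0 in gc *.
have d t : (line_poly p x u - c *: 'X)^`().[t] = 0.
  rewrite derivB derivZ derivX deriv_line_poly_dir !hornerE horner_line_poly gc.
  by rewrite subrr.
have := horner_eq_deriv0 d 1 0.
rewrite !hornerE !horner_line_poly scale1r scale0r addr0 subr0 => <-.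
by rewrite subrK.
Qed.

Definition mconvex p := forall x y t, 0 <= t -> t <= 1 ->
  mev p (t *: x + (1 - t) *: y) <= t * mev p x + (1 - t) * mev p y.

(** This is [convex_poly_growth] for [t |-> p(z + t u)], whose coefficient of degree 2 is half the
    Hessian form; hence the extra factor 2. *)
Lemma mconvex_growth p (k : nat) z u :
  mconvex p -> (0 < k)%N -> (msize p <= k.+1)%N ->
  0 <= (u^T *m hessian p z *m u) 0 0 /\
  (u^T *m hessian p z *m u) 0 0 <=
    (2 * (k * 2 ^ k))%:R * (mev p (z + u) - mev p z - (gradient p z *m u) 0 0).
Proof.
move=> pc k0 sp; pose q := line_poly p z u.
have sq : (size q <= k.+1)%N by apply: leq_trans (size_line_poly _ _ _) sp.
have q2 : (u^T *m hessian p z *m u) 0 0 = 2 * q`_2.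
  rewrite -mev_dir_mderiv2 mulr_natl.
  have -> : q`_2 *+ 2 = q^`()^`()`_0 by rewrite !coef_deriv mulr1n.
  by rewrite -horner_coef0 !deriv_line_poly_dir horner_line_poly scale0r addr0.
have q1 : (gradient p z *m u) 0 0 = q`_1.
  rewrite -mev_dir_mderiv; have -> : q`_1 = q^`()`_0 by rewrite coef_deriv mulr1n.
  by rewrite -horner_coef0 deriv_line_poly_dir horner_line_poly scale0r addr0.
have [|q20 q2le] := convex_poly_growth k0 sq.
  move=> a t t0 t1; rewrite !horner_line_poly scale0r addr0.
  have := pc (z + a *: u) z t t0 t1.
  congr (mev _ _ <= _); rewrite scalerDr scalerA addrAC -scalerDl.
  by rewrite addrCA subrr addr0 scale1r.
rewrite q2 q1; split; first by rewrite mulr_ge0.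
have := q2le; rewrite !horner_line_poly scale1r scale0r addr0 => H.
by rewrite (natrM _ 2) -mulrA ler_wpM2l.
Qed.

(** For [a > 0] the value at [(- b, a)] is [a * (a * c - b ^+ 2)]. For [a = 0] and [b != 0] the form
    takes the value -1 at [(- (c + 1) / (2 * b), 1)]. *)
Lemma binary_form_ge0_discr (a b c : R) :
  (forall s t, 0 <= a * s ^+ 2 + 2 * b * s * t + c * t ^+ 2) -> b ^+ 2 <= a * c.
Proof.
move=> H; have a0 : 0 <= a by have := H 1 0; lra.
move: a0; rewrite le_eqVlt => /orP[/eqP a0|a0]; last first.
  have H' := H (- b) a.
  by rewrite -subr_ge0 -(pmulr_rge0 _ a0); lra.
have [->|b0] := eqVneq b 0; first by rewrite expr0n -a0 mul0r.
have := H (- (c + 1) / (2 * b)) 1; rewrite -a0.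
have -> : 2 * b * (- (c + 1) / (2 * b)) = - (c + 1) by field.
lra.
Qed.

(** The Cauchy-Schwarz inequality for the semidefinite form [H], applied to the basis vector [e_i]
    and [u]. *)
Lemma psd_row_le (H : 'M[R]_n) u i :
  H^T = H -> (forall v : 'cV[R]_n, 0 <= (v^T *m H *m v) 0 0) ->
  ((H *m u) i 0) ^+ 2 <= H i i * (u^T *m H *m u) 0 0.
Proof.
move=> Hs Hp; apply: binary_form_ge0_discr => s t.
pose e := delta_mx i 0 : 'cV[R]_n.
have := Hp (s *: e + t *: u).
have eH (w : 'cV[R]_n) : (e^T *m H *m w) 0 0 = (H *m w) i 0.
  by rewrite -mulmxA trmx_delta -rowE mxE.
have He : (H *m e) i 0 = H i i by rewrite -colE mxE.
have uHe : (u^T *m H *m e) 0 0 = (H *m u) i 0.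
  have -> : u^T *m H *m e = (e^T *m H *m u)^T by rewrite !trmx_mul trmxK Hs mulmxA.
  by rewrite mxE eH.
have -> : (s *: e + t *: u)^T = s *: e^T + t *: u^T by apply/rowP => j; rewrite !mxE.
rewrite !mulmxDl !mulmxDr -!scalemxAl -!scalemxAr.
move: uHe (eH u) (eH e); rewrite He; move: ((H *m u) i 0) => b.
move: (e^T *m H *m e) (e^T *m H *m u) (u^T *m H *m e) (u^T *m H *m u) => x1 x2 x3 x4.
by move=> e3 e2 e1; rewrite !mxE e1 e2 e3 => h; apply: le_trans h _; lra.
Qed.

End RealMpoly.
(** * Small solutions of linear inequalities *)

(* As long as some direction in the kernel of the tight rows is not in the kernel
   of M, moving along it (or its opposite) makes a further row tight. *)
Lemma exists_tight_solution (R : realFieldType) (m n : nat) (M : 'M[R]_(m, n))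
    (r : 'cV[R]_m) (c : 'rV[R]_n) (x : 'cV[R]_n) :
  (forall i, (M *m x) i 0 <= r i 0) ->
  (forall v : 'cV[R]_n, (forall i, (M *m v) i 0 <= 0) -> 0 <= (c *m v) 0 0) ->
  exists y : 'cV[R]_n,
    [/\ forall i, (M *m y) i 0 <= r i 0, (c *m y) 0 0 <= (c *m x) 0 0 &
        forall u : 'cV[R]_n,
          (forall i, (M *m y) i 0 = r i 0 -> (M *m u) i 0 = 0) -> M *m u = 0].
Proof.
move=> Mx rec; pose slack (y : 'cV[R]_n) := [set i | (M *m y) i 0 != r i 0].
have [k] := ubnP #|slack x|; elim: k x Mx => // k IH x Mx.
rewrite ltnS => sk.
pose blocked (u : 'cV[R]_n) := forall i, (M *m x) i 0 = r i 0 -> (M *m u) i 0 = 0.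
have [[u [bu Mu]]|nou] := Classical_Prop.classic (exists u, blocked u /\ M *m u <> 0);
  last first.
  exists x; split => // u bu; apply: Classical_Prop.NNPP => Mu.
  by apply: nou; exists u.
(* Orient [u] so that the objective does not increase. If it strictly decreases, the hypothesis on
   recession directions provides a row that increases; if it is constant, the sign is chosen to make
   some row increase. *)
have {u bu Mu} [u [bu cu [i0 ui0]]] : exists u : 'cV[R]_n,
    [/\ blocked u, (c *m u) 0 0 <= 0 & exists i, 0 < (M *m u) i 0].
  have pos (v : 'cV[R]_n) : (c *m v) 0 0 < 0 -> exists i, 0 < (M *m v) i 0.
    move=> cv; apply: Classical_Prop.NNPP => H; move: cv; rewrite ltNge rec // => i.
    by rewrite leNgt; apply/negP => ?; apply: H; exists i.
  have bN : blocked (- u) by move=> i /bu; rewrite mulmxN !mxE => ->; rewrite oppr0.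
  have [cu|cu|cu] := ltgtP ((c *m u) 0 0) 0.
  - by exists u; split => //; [exact: ltW|exact: pos].
  - have cN : (c *m - u) 0 0 < 0 by rewrite mulmxN mxE oppr_lt0.
    by exists (- u); split => //; [exact: ltW|exact: pos].
  have [i ui] : exists i, (M *m u) i 0 != 0.
    apply: Classical_Prop.NNPP => H; apply: Mu; apply/colP => i; rewrite [RHS]mxE.
    by apply/eqP; apply: contraT => ?; case: H; exists i.
  have [ui0|ui0|/eqP] := ltgtP ((M *m u) i 0) 0; last by rewrite (negbTE ui).
  - exists (- u); split => //; first by rewrite mulmxN mxE cu oppr0.
    by exists i; rewrite mulmxN mxE oppr_gt0.
  - by exists u; split => //; [rewrite cu|exists i].
(* The step length at which row [j] becomes tight. The smallest one keeps feasibility and makes row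
   [jm] tight, while [blocked] keeps tight rows tight. *)
pose gap j := (r j 0 - (M *m x) j 0) / (M *m u) j 0.
pose jm := [arg min_(j < i0 | 0 < (M *m u) j 0) gap j]%O.
have [uj gmin] : 0 < (M *m u) jm 0 /\
    forall j, 0 < (M *m u) j 0 -> gap jm <= gap j.
  by rewrite /jm; case: arg_minP => // j uj Hj.
have gap0 : 0 <= gap jm by rewrite divr_ge0 ?subr_ge0 // ltW.
pose y := x + gap jm *: u.
have My i : (M *m y) i 0 = (M *m x) i 0 + gap jm * (M *m u) i 0.
  by rewrite mulmxDr -scalemxAr !mxE.
have My_le i : (M *m y) i 0 <= r i 0.
  rewrite My; have [ui|ui] := ltrP 0 ((M *m u) i 0).
    have := gmin i ui; rewrite /gap ler_pdivlMr // => H; lra.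
  have := Mx i; have : gap jm * (M *m u) i 0 <= 0 by rewrite mulr_ge0_le0.
  lra.
have jmx : jm \in slack x.
  by rewrite inE; apply/eqP => /bu uj0; rewrite uj0 ltxx in uj.
have jmy : jm \notin slack y.
  rewrite inE negbK; apply/eqP; rewrite My /gap divfK ?gt_eqF //; ring.
have sub : slack y \proper slack x.
  apply/properP; split; last by exists jm.
  apply/subsetP => i; rewrite !inE; apply: contra => /eqP ei.
  by rewrite My (bu i ei) mulr0 addr0 ei.
have [|z [z1 z2 z3]] := IH y My_le.
  by apply: leq_trans sk; exact: proper_card.
exists z; split => //; apply: le_trans z2 _.
rewrite mulmxDr -scalemxAr [X in X <= _]mxE [X in _ + X]mxE gerDl.
by rewrite mulr_ge0_le0.
Qed.

Lemma norm_det_le (R : realFieldType) (k : nat) (S : 'M[R]_k) (B : R) :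
  (forall i j, `|S i j| <= B) -> `|\det S| <= k`!%:R * B ^+ k.
Proof.
move=> SB; rewrite /determinant; apply: le_trans (ler_norm_sum _ _ _) _.
have -> : k`!%:R * B ^+ k = \sum_(s : 'S_k) B ^+ k.
  by rewrite sumr_const card_Sn mulr_natl.
apply: ler_sum => s _; rewrite normrM normr_sign mul1r normr_prod.
have -> : B ^+ k = \prod_(i < k) B by rewrite prodr_const card_ord.
by apply: ler_prod => i _; rewrite normr_ge0 SB.
Qed.

(** A nonzero integer determinant has absolute value at least 1, so the entries of the inverse are
    no larger than the cofactors, which the Leibniz formula bounds. *)
Lemma norm_invmx_le (R : archiRealFieldType) (k : nat) (S : 'M[R]_k) (B : R) :
  1 <= B -> (forall i j, S i j \is a Num.int) -> (forall i j, `|S i j| <= B) ->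
  S \in unitmx -> forall i j, `|invmx S i j| <= k`!%:R * B ^+ k.
Proof.
move=> B1 Sint SB Su i j; have B0 : 0 <= B by apply: le_trans B1.
have detint : \det S \is a Num.int.
  apply: rpred_sum => s _; apply: rpredM; first by rewrite rpredX // rpredN rpred1.
  by apply: rpred_prod.
have det1 : 1 <= `|\det S|.
  by apply: norm_intr_ge1 => //; move: Su; rewrite unitmxE unitfE.
have cof : `|cofactor S j i| <= k`!%:R * B ^+ k.
  rewrite normrM normrX normrN1 expr1n mul1r.
  apply: (le_trans (@norm_det_le _ _ _ B _)) => [a b|].
    by rewrite !mxE SB.
  have k0 : (0 < k)%N by case: (k) i => [[]|].
  apply: ler_pM; rewrite ?ler0n ?exprn_ge0 //.
    by rewrite ler_nat; case: (k) k0 => // k' _; rewrite factS leq_pmull.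
  by apply: ler_weXn2l => //; rewrite leq_pred.
rewrite /invmx Su mxE mxE normrM normfV.
apply: le_trans cof; rewrite ler_piMl ?normr_ge0 // invf_le1 //.
exact: lt_le_trans det1.
Qed.

(** Select a maximal independent set of rows [N], then columns of [N] forming an invertible square
    matrix [S]. The solution supported on these columns is controlled by the inverse of [S]. One
    factor [n] comes from the product with this inverse, the other from a crude bound on the sum
    defining [z]. *)
Lemma exists_small_solution (R : archiRealFieldType) (m n : nat)
    (M : 'M[R]_(m, n)) (y : 'cV[R]_n) (B rho : R) :
  1 <= B -> 0 <= rho ->
  (forall i j, M i j \is a Num.int) -> (forall i j, `|M i j| <= B) ->
  (forall i, `|(M *m y) i 0| <= rho) ->
  exists2 z : 'cV[R]_n, M *m z = M *m y &
    forall j, `|z j 0| <= (n ^ 2 * n`!)%:R * B ^+ n * rho.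
Proof.
move=> B1 rho0 Mint MB yrho; have B0 : 0 <= B by apply: le_trans B1.
pose f := maxrankfun M; pose N := rowsub f M.
have NM : (N :=: M)%MS by exact: eq_maxrowsub.
have fN : row_free N by exact: maxrowsub_free.
have fNT : row_full N^T by rewrite /row_full mxrank_tr; move: fN; rewrite /row_free.
pose g := fullrankfun fNT; pose S := (rowsub g N^T)^T.
have Su : S \in unitmx by rewrite unitmx_tr fullrowsub_unit.
pose w := invmx S *m (N *m y).
pose z : 'cV[R]_n := \col_j \sum_i (g i == j)%:R * w i 0.
have Nz : N *m z = N *m y.
  have -> : N *m z = S *m w.
    apply/colP => a; rewrite !mxE.
    under eq_bigr => j _ do rewrite [z j 0]mxE mulr_sumr.
    rewrite exchange_big /=; apply: eq_bigr => i _.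
    rewrite (bigD1 (g i)) //= eqxx mul1r big1 ?addr0 ?[S a i]mxE ?mxE //.
    by move=> j; rewrite eq_sym => /negbTE ->; rewrite mul0r mulr0.
  by rewrite mulmxA mulmxV // mul1mx.
exists z.
  (* All rows of [M] are combinations of those of [N], so agreement on [N] suffices. *)
  have /submxP[X ->] : (M <= N)%MS by rewrite NM.
  by rewrite -!mulmxA Nz.
have kn : (\rank M <= n)%N := rank_leq_col M.
pose K := (\rank M)`!%:R * B ^+ \rank M.
have K0 : 0 <= K by rewrite mulr_ge0 ?ler0n ?exprn_ge0.
have KK : K <= n`!%:R * B ^+ n.
  apply: ler_pM; rewrite ?ler0n ?exprn_ge0 //; first by rewrite ler_nat leq_fact.
  exact: ler_weXn2l.
have wle i : `|w i 0| <= n%:R * (K * rho).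
  rewrite mxE; apply: le_trans (ler_norm_sum _ _ _) _.
  have -> : n%:R * (K * rho) = \sum_(j < n) K * rho.
    by rewrite sumr_const card_ord mulr_natl.
  apply: le_trans (_ : _ <= \sum_(j < \rank M) K * rho) _; last first.
    by rewrite !sumr_const !card_ord -!(mulr_natl (K * rho)) ler_wpM2r ?ler_nat // mulr_ge0.
  apply: ler_sum => a _; rewrite normrM ler_pM ?normr_ge0 //.
    apply: norm_invmx_le => // b b'; rewrite !mxE //.
  have -> : (N *m y) a 0 = (M *m y) (f a) 0.
    by rewrite !mxE; apply: eq_bigr => j _; rewrite mxE.
  exact: yrho.
move=> j; rewrite mxE; apply: le_trans (ler_norm_sum _ _ _) _.
apply: le_trans (_ : _ <= \sum_(i < \rank M) n%:R * (K * rho)) _.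
  apply: ler_sum => i _; rewrite normrM; apply: le_trans (wle i).
  by rewrite ler_piMl ?normr_ge0 //; case: eqP; rewrite ?normr1 ?normr0.
rewrite sumr_const card_ord -[_ *+ _]mulr_natl natrM natrX expr2.
have nR : (\rank M)%:R <= n%:R :> R by rewrite ler_nat.
apply: le_trans (_ : _ <= n%:R * (n%:R * (K * rho))) _.
  by apply: ler_wpM2r => //; rewrite mulr_ge0 ?ler0n // mulr_ge0.
have -> : n%:R * n%:R * n`!%:R * B ^+ n * rho = n%:R * (n%:R * (n`!%:R * B ^+ n * rho)) by ring.
by do 2! [apply: ler_wpM2l; rewrite ?ler0n //]; rewrite ler_wpM2r.
Qed.

(** At the point [y] of [exists_tight_solution], solve the tight equations by a small [z]. Then
    [z - y] is killed by the tight rows, hence by [M], so [z] has the same slacks as [y]. Since [M]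
    kills [y - z], this is a recession direction and the objective at [z] is at most that at [y]. *)
Lemma exists_small_feasible (R : archiRealFieldType) (m n : nat)
    (M : 'M[R]_(m, n)) (r : 'cV[R]_m) (c : 'rV[R]_n) (x : 'cV[R]_n) (B rho : R) :
  1 <= B -> 0 <= rho ->
  (forall i j, M i j \is a Num.int) -> (forall i j, `|M i j| <= B) ->
  (forall i, `|r i 0| <= rho) ->
  (forall i, (M *m x) i 0 <= r i 0) ->
  (forall v : 'cV[R]_n, (forall i, (M *m v) i 0 <= 0) -> 0 <= (c *m v) 0 0) ->
  exists y : 'cV[R]_n,
    [/\ forall i, (M *m y) i 0 <= r i 0, (c *m y) 0 0 <= (c *m x) 0 0 &
        forall j, `|y j 0| <= (n ^ 2 * n`!)%:R * B ^+ n * rho].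
Proof.
move=> B1 rho0 Mint MB rrho Mx rec.
have [y [y1 y2 y3]] := exists_tight_solution Mx rec.
pose T := [set i | (M *m y) i 0 == r i 0].
pose N := rowsub (fun i : 'I_#|T| => enum_val i) M.
have NE (v : 'cV[R]_n) i : (N *m v) i 0 = (M *m v) (enum_val i) 0.
  by rewrite !mxE; apply: eq_bigr => j _; rewrite mxE.
have [||||i|z Nz zB] := @exists_small_solution R _ _ N y B rho _ _ _ _ _ => //.
- by move=> i j; rewrite mxE.
- by move=> i j; rewrite mxE.
- by rewrite NE; have /[!inE]/eqP -> := enum_valP i.
have Muz : M *m (z - y) = 0.
  apply: y3 => i /eqP ei; have iT : i \in T by rewrite inE.
  have := congr1 (fun v : 'cV[R]_#|T| => v (enum_rank_in iT i) 0) Nz.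
  rewrite !NE enum_rankK_in // => e.
  by rewrite mulmxBr mxE e [X in _ + X]mxE subrr.
have Mzy : M *m z = M *m y by apply/eqP; rewrite -subr_eq0 -mulmxBr Muz.
exists z; split => [i||//]; first by rewrite Mzy.
apply: le_trans y2; rewrite -subr_ge0.
have -> : (c *m y) 0 0 - (c *m z) 0 0 = (c *m (y - z)) 0 0.
  by rewrite mulmxBr !mxE.
apply: rec => i; rewrite -opprB mulmxN Muz.
by rewrite !mxE oppr0.
Qed.

(** Indexing constraints by any finite type lets systems of mixed constraints be written by cases on
    a sum type. *)
Lemma exists_small_feasible_fin (R : archiRealFieldType) (T : finType) (n : nat)
    (a : T -> 'rV[R]_n) (r : T -> R) (c : 'rV[R]_n) (x : 'cV[R]_n) (B rho : R) :
  1 <= B -> 0 <= rho ->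
  (forall t j, a t 0 j \is a Num.int) -> (forall t j, `|a t 0 j| <= B) ->
  (forall t, `|r t| <= rho) ->
  (forall t, (a t *m x) 0 0 <= r t) ->
  (forall v : 'cV[R]_n, (forall t, (a t *m v) 0 0 <= 0) -> 0 <= (c *m v) 0 0) ->
  exists y : 'cV[R]_n,
    [/\ forall t, (a t *m y) 0 0 <= r t, (c *m y) 0 0 <= (c *m x) 0 0 &
        forall j, `|y j 0| <= (n ^ 2 * n`!)%:R * B ^+ n * rho].
Proof.
move=> B1 rho0 aint aB rrho ax rec.
pose M : 'M[R]_(#|T|, n) := \matrix_(i, j) a (enum_val i) 0 j.
pose b : 'cV[R]_#|T| := \col_i r (enum_val i).
have ME (v : 'cV[R]_n) i : (M *m v) i 0 = (a (enum_val i) *m v) 0 0.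
  by rewrite !mxE; apply: eq_bigr => j _; rewrite mxE.
have [|||||y [y1 y2 y3]] :=
    @exists_small_feasible R _ _ M b c x B rho B1 rho0 => //.
- by move=> i j; rewrite mxE.
- by move=> i j; rewrite mxE.
- by move=> i; rewrite mxE.
- by move=> i; rewrite ME [b i 0]mxE.
- move=> v Mv; apply: rec => t; have := Mv (enum_rank t).
  by rewrite ME enum_rankK.
exists y; split => // t; have := y1 (enum_rank t).
by rewrite ME [b _ 0]mxE enum_rankK.
Qed.

(** * Size estimates *)

Section EvaluationBounds.
Variables (R : archiRealFieldType) (n : nat).
Implicit Types (p : {mpoly R[n]}) (x : 'cV[R]_n).

Lemma mev_sumX (I : Type) (s : seq I) (a : I -> R) (e : I -> 'X_{1..n}) x :
  mev (\sum_(t <- s) a t *: 'X_[e t]) x = \sum_(t <- s) a t * \prod_i x i 0 ^+ e t i.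
Proof. by rewrite mev_sumZ; apply: eq_bigr => t _; rewrite /mev mevalX. Qed.

(** The exponents [e t] may repeat, so the bound applies directly to termwise derivatives, where
    distinct monomials can collide. *)
Lemma norm_mev_sumX (I : eqType) (s : seq I) (a : I -> R) (e : I -> 'X_{1..n}) x
    (N : nat) (C X : R) :
  (size s <= N)%N -> (forall t, t \in s -> mdeg (e t) <= N)%N -> 0 <= C ->
  (forall t, t \in s -> `|a t| <= C) -> 1 <= X -> (forall i, `|x i 0| <= X) ->
  `|mev (\sum_(t <- s) a t *: 'X_[e t]) x| <= N%:R * C * X ^+ N.
Proof.
move=> sN eN C0 aC X1 xX; have X0 : 0 <= X by apply: le_trans X1.
rewrite mev_sumX; apply: le_trans (ler_norm_sum _ _ _) _.
apply: le_trans (_ : _ <= \sum_(t <- s) C * X ^+ N) _; last first.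
  rewrite big_const_seq count_predT iter_addr_0 -(mulr_natl (C * _)) -mulrA.
  by rewrite ler_wpM2r ?ler_nat // mulr_ge0 ?exprn_ge0.
rewrite big_seq [leRHS]big_seq; apply: ler_sum => t ts.
rewrite normrM ler_pM ?aC // normr_prod.
apply: le_trans (_ : _ <= \prod_i X ^+ e t i) _.
  by apply: ler_prod => i _; rewrite normr_ge0 normrX lerXn2r ?nnegrE.
rewrite prodrXr -mdegE; apply: ler_weXn2l => //; exact: eN.
Qed.

Lemma int_mev_sumX (I : eqType) (s : seq I) (a : I -> R) (e : I -> 'X_{1..n}) x
    (D : R) :
  (forall t, t \in s -> D * a t \is a Num.int) ->
  (forall i, x i 0 \is a Num.int) ->
  D * mev (\sum_(t <- s) a t *: 'X_[e t]) x \is a Num.int.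
Proof.
move=> aD xi; rewrite mev_sumX mulr_sumr big_seq; apply: rpred_sum => t ts.
rewrite mulrA rpredM ?aD //; apply: rpred_prod => i _; exact: rpredX.
Qed.

Lemma mderiv_sumX (I : Type) (s : seq I) (a : I -> R) (e : I -> 'X_{1..n}) i :
  (\sum_(t <- s) a t *: 'X_[e t])^`M(i) =
  \sum_(t <- s) (a t * (e t i)%:R) *: 'X_[(e t - U_(i))%MM].
Proof.
rewrite raddf_sum /=; apply: eq_bigr => t _.
by rewrite mderivZ mderivX scalerA.
Qed.

Variables (p : {mpoly R[n]}) (N : nat) (C : R).
Hypotheses (sN : (size (msupp p) <= N)%N) (dN : (msize p <= N.+1)%N)
  (C0 : 0 <= C) (pC : forall m, `|p@_m| <= C).

Let mdegN m : m \in msupp p -> (mdeg m <= N)%N.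
Proof. by move=> /msize_mdeg_lt H; rewrite -ltnS (leq_trans H). Qed.

Let le_mdeg (m : 'X_{1..n}) i : (m i <= mdeg m)%N.
Proof. by rewrite mdegE (bigD1 i) //= leq_addr. Qed.

Let mderiv2E i j : p^`M(i)^`M(j) =
  \sum_(m <- msupp p) (p@_m * (m i)%:R * ((m - U_(i))%MM j)%:R) *:
    'X_[(m - U_(i) - U_(j))%MM].
Proof. by rewrite {1}(mpolyE p) 2!(mderiv_sumX (msupp p)). Qed.

Variables (x : 'cV[R]_n) (X : R).
Hypotheses (X1 : 1 <= X) (xX : forall i, `|x i 0| <= X).

Lemma norm_mev_le : `|mev p x| <= N%:R * C * X ^+ N.
Proof. by rewrite (mpolyE p); apply: norm_mev_sumX. Qed.

Lemma norm_gradient_le i : `|gradient p x 0 i| <= N%:R * (C * N%:R) * X ^+ N.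
Proof.
rewrite mxE {1}(mpolyE p) (mderiv_sumX (msupp p)); apply: norm_mev_sumX => //.
- by move=> m mp; apply: leq_trans (mdegB _ _) (mdegN mp).
- by rewrite mulr_ge0.
- move=> m mp; rewrite normrM ler_pM //= normr_nat ler_nat.
  exact: leq_trans (le_mdeg _ _) (mdegN mp).
Qed.

Lemma norm_hessian_le i j :
  `|hessian p x i j| <= N%:R * (C * N%:R * N%:R) * X ^+ N.
Proof.
rewrite mxE mderiv2E; apply: norm_mev_sumX => //.
- move=> m mp; apply: leq_trans (mdegB _ _) _.
  by apply: leq_trans (mdegB _ _) (mdegN mp).
- by rewrite !mulr_ge0.
- move=> m mp; rewrite normrM normrM !normr_nat.
  have le1 : (m i)%:R <= N%:R :> R.
    by rewrite ler_nat; exact: leq_trans (le_mdeg _ _) (mdegN mp).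
  have le2 : ((m - U_(i))%MM j)%:R <= N%:R :> R.
    rewrite ler_nat; apply: leq_trans (le_mdeg _ _) _.
    by apply: leq_trans (mdegB _ _) (mdegN mp).
  by rewrite !ler_pM ?mulr_ge0.
Qed.

Lemma int_hessian (D : R) i j :
  (forall m, D * p@_m \is a Num.int) -> (forall i, x i 0 \is a Num.int) ->
  D * hessian p x i j \is a Num.int.
Proof.
move=> pD xi; rewrite mxE mderiv2E.
apply: int_mev_sumX => // m _.
by rewrite !mulrA rpredM // ?natr_int // rpredM // natr_int.
Qed.

End EvaluationBounds.

(** * Shrinking points of a sublevel set *)

Section ShrinkingSublevelPoints.
Variables (R : archiRealFieldType) (n m N : nat).
Variables (p : {mpoly R[n]}) (A : 'M[R]_(m, n)) (b : 'cV[R]_m).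
(** [DA] and [Df] clear the denominators of [A] and of the grid Hessians, [B] bounds the resulting
    integer entries, and [E] dominates all remaining data: right-hand sides, values and derivatives
    on the grid, and the Cramer and growth constants. [lb] is a lower bound of [p] on [P]. *)
Variables (DA Df B E lb : R).

Let grid (g : {ffun 'I_n -> 'I_N.+1}) : 'cV[R]_n := \col_i (g i)%:R.
Let P (x : 'cV[R]_n) := forall i, (A *m x) i 0 <= b i 0.

Hypotheses (n_gt0 : (0 < n)%N) (N_gt0 : (0 < N)%N).
Hypotheses (p_convex : mconvex p) (p_deg : (msize p <= N.+1)%N).
Hypotheses (E_ge8 : 8 <= E) (B_ge1 : 1 <= B).
Hypotheses (DA_ge1 : 1 <= DA) (Df_ge1 : 1 <= Df) (DfE : Df <= E).
Hypotheses (A_int : forall i j, DA * A i j \is a Num.int)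
  (A_le : forall i j, `|DA * A i j| <= B) (b_le : forall i, `|DA * b i 0| <= E).
Hypotheses
  (H_int : forall g i j, Df * hessian p (grid g) i j \is a Num.int)
  (H_le : forall g i j, `|Df * hessian p (grid g) i j| <= B)
  (HE : forall g i j, `|hessian p (grid g) i j| <= E)
  (HzE : forall g i, `|(hessian p (grid g) *m grid g) i 0| <= E).
Hypotheses (cramerE : (n ^ 2 * n`!)%:R * B ^+ n <= E)
  (growthE : (2 * (N * 2 ^ N))%:R <= E) (NE : N%:R <= E).
Hypotheses (pE : forall g, `|mev p (grid g)| <= E)
  (gradE : forall g, \sum_j `|gradient p (grid g) 0 j| <= E).

Let E_gt0 : 0 < E. Proof. by apply: lt_le_trans E_ge8. Qed.
Let E_ge0 : 0 <= E := ltW E_gt0.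
Let Df_gt0 : 0 < Df. Proof. by apply: lt_le_trans Df_ge1. Qed.
Let DA_gt0 : 0 < DA. Proof. by apply: lt_le_trans DA_ge1. Qed.

(** Each entry of [hessian p x *m u] is a polynomial in [x] of size at most [N.+1], so it vanishes
    everywhere once it vanishes on the grid. This leaves finitely many linear conditions on [u]. *)
Let hessian_kernel u : (forall g, hessian p (grid g) *m u = 0) ->
  forall x, mev p (x + u) = mev p x + (gradient p 0 *m u) 0 0.
Proof.
move=> Hu; apply: mev_affine_along => x; apply/colP => i.
rewrite -mev_mderiv_dir_mderiv [RHS]mxE; apply: (@mev_eq0_on_grid _ _ _ N).
  apply: leq_trans (msize_mderiv _ _) _.
  exact: leq_trans (msize_dir_mderiv _ _) p_deg.
by move=> g; rewrite mev_mderiv_dir_mderiv Hu mxE.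
Qed.

Lemma gradient_recession (x0 v : 'cV[R]_n) :
  (forall x, P x -> lb <= mev p x) -> P x0 ->
  (forall i, (A *m v) i 0 <= 0) -> (forall g, hessian p (grid g) *m v = 0) ->
  0 <= (gradient p 0 *m v) 0 0.
Proof.
move=> p_lb Px0 Av Hv; rewrite leNgt; apply/negP => cv.
set c := (_ *m _) 0 0 in cv.
(* After this step length [p] would take the value [lb - 1]. *)
pose t := (mev p x0 - lb + 1) / - c.
have c0 : 0 < - c by rewrite oppr_gt0.
have t0 : 0 <= t.
  by rewrite divr_ge0 ?ltW //; have := p_lb _ Px0; lra.
have Ptv : P (x0 + t *: v).
  move=> i; rewrite mulmxDr -scalemxAr [X in X <= _]mxE [X in _ + X]mxE.
  have := Px0 i; have : t * (A *m v) i 0 <= 0 by rewrite mulr_ge0_le0.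
  lra.
have := p_lb _ Ptv; rewrite hessian_kernel; last first.
  by move=> g; rewrite -scalemxAr Hv scaler0.
rewrite -scalemxAr [X in _ + X]mxE -/c.
have : t * - c = mev p x0 - lb + 1 by rewrite divfK ?gt_eqF.
lra.
Qed.

Let scaled_row k (M : 'M[R]_(k, n)) (a : R) i (v : 'cV[R]_n) :
  ((a *: row i M) *m v) 0 0 = a * (M *m v) i 0.
Proof. by rewrite -scalemxAl mxE -row_mul mxE. Qed.

(* The constraint system fixes all H(z) y by pairs of opposite inequalities, and
   [gradient p 0] plays the role of the objective. *)
Lemma exists_small_lower_point (x : 'cV[R]_n) (W : R) :
  (forall x, P x -> lb <= mev p x) -> P x -> 0 <= W ->
  (forall g i, `|(hessian p (grid g) *m x) i 0| <= W) ->
  exists y : 'cV[R]_n,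
    [/\ P y, mev p y <= mev p x, forall j, `|y j 0| <= E ^+ 2 * (1 + W) &
        forall g, hessian p (grid g) *m y = hessian p (grid g) *m x].
Proof.
move=> p_lb Px W0 HW.
pose T : finType := ('I_m + {ffun 'I_n -> 'I_N.+1} * 'I_n * bool)%type.
pose a (t : T) : 'rV[R]_n := match t with
  | inl i => DA *: row i A
  | inr (g, i, s) => ((-1) ^+ s * Df) *: row i (hessian p (grid g))
  end.
pose r (t : T) : R := match t with
  | inl i => DA * b i 0
  | inr (g, i, s) => (-1) ^+ s * Df * (hessian p (grid g) *m x) i 0
  end.
have sgn_norm (s : bool) : `|(-1) ^+ s : R| = 1 by rewrite normr_sign.
have [||||||y [y1 y2 y3]] := @exists_small_feasible_fin R T n a r (gradient p 0) x B
    (E * (1 + W)) B_ge1.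
- by rewrite mulr_ge0 // addr_ge0.
- move=> [i|[[g i] s]] j /=; first by rewrite !mxE.
  by rewrite !mxE -mulrA rpredM // ?rpredX ?rpredN ?rpred1 //; have := H_int g i j; rewrite mxE.
- move=> [i|[[g i] s]] j /=; first by rewrite !mxE.
  by rewrite !mxE -mulrA normrM sgn_norm mul1r; have := H_le g i j; rewrite mxE.
- move=> [i|[[g i] s]] /=.
    by apply: le_trans (b_le i) _; rewrite ler_peMr // lerDl.
  rewrite -mulrA normrM sgn_norm mul1r normrM (ger0_norm (ltW Df_gt0)).
  apply: ler_pM => //; first exact: ltW.
  by apply: le_trans (HW g i) _; rewrite lerDr.
- move=> [i|[[g i] s]]; rewrite /a /r scaled_row //.
  by rewrite ler_pM2l.
- move=> v av; apply: (gradient_recession p_lb Px) => [i|g].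
    by have := av (inl i); rewrite /a scaled_row pmulr_rle0.
  apply/colP => i; rewrite [RHS]mxE; apply/eqP; rewrite eq_le.
  have := av (inr (g, i, false)); have := av (inr (g, i, true)); rewrite /a !scaled_row.
  rewrite expr0 expr1 mul1r mulN1r mulNr oppr_le0 pmulr_rle0 // pmulr_rge0 //.
  by move=> -> ->.
have Hyx g : hessian p (grid g) *m y = hessian p (grid g) *m x.
  apply/colP => i; apply/eqP; rewrite eq_le.
  have := y1 (inr (g, i, false)); have := y1 (inr (g, i, true)); rewrite /a /r !scaled_row.
  rewrite expr0 expr1 mul1r mulN1r !mulNr lerN2 !ler_pM2l //.
  by move=> -> ->.
exists y; split => //.
- by move=> i; have := y1 (inl i); rewrite /a /r scaled_row ler_pM2l.
(* All grid Hessians kill [y - x], so [p] changes exactly as its linear part at 0 does. *)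
- have -> : mev p y = mev p x + (gradient p 0 *m (y - x)) 0 0.
    have -> : mev p y = mev p (x + (y - x)) by rewrite addrC subrK.
    by rewrite hessian_kernel // => g; rewrite mulmxBr Hyx subrr.
  by rewrite mulmxBr [X in _ + X]mxE [X in _ + (_ + X)]mxE gerDl subr_le0.
- move=> j; apply: le_trans (y3 j) _.
  have -> : E ^+ 2 * (1 + W) = E * (E * (1 + W)) by ring.
  by rewrite ler_wpM2r // mulr_ge0 // addr_ge0.
Qed.

(** With [u = y - z], Cauchy-Schwarz bounds the square by [H i i] times the Hessian form at [u]. The
    growth inequality bounds that form by [E] times the gap between [p(y)] and the tangent at [z],
    and this gap is at most [2 E + E (Y + E)]. *)
Lemma hessian_entry_bound (y : 'cV[R]_n) (Y : R) g i :
  mev p y <= E -> 0 <= Y -> (forall j, `|y j 0| <= Y) ->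
  ((hessian p (grid g) *m (y - grid g)) i 0) ^+ 2 <= E ^+ 2 * (2 * E + E * (Y + E)).
Proof.
move=> py Y0 yY; set z := grid g; set u := y - z; set H := hessian p z.
have psd (v : 'cV[R]_n) : 0 <= (v^T *m H *m v) 0 0.
  by case: (mconvex_growth z v p_convex N_gt0 p_deg).
have [_] := mconvex_growth z u p_convex N_gt0 p_deg.
have -> : z + u = y by rewrite addrC subrK.
rewrite -/H; set q := (u^T *m H *m u) 0 0 => growth.
have q0 : 0 <= q := psd u.
have gu : - (gradient p z *m u) 0 0 <= E * (Y + E).
  rewrite -mulN1r; apply: le_trans (ler_norm _) _.
  rewrite normrM normrN1 mul1r mxE; apply: le_trans (ler_norm_sum _ _ _) _.
  apply: le_trans (_ : _ <= \sum_j `|gradient p z 0 j| * (Y + E)) _.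
    apply: ler_sum => j _; rewrite normrM ler_wpM2l // /u /z !mxE.
    apply: le_trans (ler_normB _ _) _; rewrite lerD // normr_nat.
    by apply: le_trans NE; rewrite ler_nat -ltnS.
  by rewrite -mulr_suml ler_wpM2r ?gradE // addr_ge0.
have pz : - mev p z <= E.
  by rewrite -mulN1r; apply: le_trans (ler_norm _) _; rewrite normrM normrN1 mul1r pE.
set L := mev p y - mev p z - _ in growth.
have LE : L <= 2 * E + E * (Y + E) by rewrite /L; lra.
have K0 : (0 : R) < (2 * (N * 2 ^ N))%:R by rewrite ltr0n !muln_gt0 N_gt0 expn_gt0.
have L0 : 0 <= L by rewrite -(pmulr_rge0 _ K0); apply: le_trans growth.
apply: le_trans (psd_row_le u i (hessian_sym p z) psd) _.
rewrite -/H -/q expr2 -mulrA; apply: ler_pM => //.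
- by have := psd (delta_mx i 0); rewrite -mulmxA trmx_delta -rowE -colE !mxE.
- by apply: le_trans (HE g i i); exact: ler_norm.
apply: le_trans growth _; apply: ler_pM => //; exact: ltW.
Qed.

(** The bound on [h ^+ 2] is only linear in [W], hence in [h], so [h] is of order [E ^+ 5]. The
    assumption [8 <= E] absorbs numerical constants into higher powers. *)
Lemma quadratic_self_bound (h W : R) :
  0 <= h -> h ^+ 2 <= E ^+ 2 * (2 * E + E * (E ^+ 2 * (1 + W) + E)) -> W <= h + E ->
  E ^+ 2 * (1 + W) <= E ^+ 8.
Proof.
move=> h0 h2 Wh.
have pow k : 8 * E ^+ k <= E ^+ k.+1.
  by rewrite exprS ler_wpM2r // exprn_ge0.
have E0 k : 0 <= E ^+ k by rewrite exprn_ge0.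
have := pow 0; have := pow 1; have := pow 2; have := pow 3; have := pow 4; have := pow 5.
have := E0 5; rewrite expr0 expr1 => e5 p5 p4 p3 p2 p1 p0.
have h2' : h ^+ 2 <= 2 * E ^+ 6 + E ^+ 5 * h.
  have W5 : E ^+ 5 * W <= E ^+ 5 * (h + E) by rewrite ler_wpM2l.
  have e6 : E ^+ 5 * E = E ^+ 6 by ring.
  have e3 : E ^+ 2 * (2 * E + E * (E ^+ 2 * (1 + W) + E)) =
    2 * E ^+ 3 + E ^+ 4 + E ^+ 5 + E ^+ 5 * W by ring.
  rewrite e3 in h2; rewrite mulrDr e6 in W5; lra.
have h5 : h <= 2 * E ^+ 5.
  rewrite leNgt; apply/negP => hlt.
  have hh : 2 * E ^+ 5 * h <= h * h by rewrite ler_wpM2r // ltW.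
  have eh : E ^+ 5 * (2 * E ^+ 5) <= E ^+ 5 * h by rewrite ler_wpM2l // ltW.
  have ee : 8 * E ^+ 6 <= E ^+ 5 * E ^+ 5.
    have -> : E ^+ 5 * E ^+ 5 = E ^+ 4 * E ^+ 6 by ring.
    rewrite ler_wpM2r //; lra.
  have := exprn_gt0 6 E_gt0; rewrite expr2 in h2'; lra.
have -> : E ^+ 8 = E ^+ 2 * E ^+ 6 by ring.
rewrite ler_wpM2l //; lra.
Qed.

(** The estimate closes on itself: the size of [y] is linear in [W], while [W] exceeds by at most
    [E] an entry whose square is linear in the size of [y]. *)
Lemma exists_bounded_lower_point (x : 'cV[R]_n) :
  (forall x, P x -> lb <= mev p x) -> P x -> mev p x <= E ->
  exists y : 'cV[R]_n, [/\ P y, mev p y <= mev p x & forall j, `|y j 0| <= E ^+ 8].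
Proof.
move=> p_lb Px px.
pose h (gi : {ffun 'I_n -> 'I_N.+1} * 'I_n) : R :=
  `|(hessian p (grid gi.1) *m x) gi.2 0|.
pose t0 : {ffun 'I_n -> 'I_N.+1} * 'I_n := ([ffun => ord0], Ordinal n_gt0).
pose t := [arg max_(t > t0) h t]%O.
have tmax s : h s <= h t by rewrite /t; case: arg_maxP => // i _; apply.
case: t tmax => g i; set W := h (g, i) => tmax.
have W0 : 0 <= W by exact: normr_ge0.
have [|y [Py pyx yB Hyx]] := exists_small_lower_point p_lb Px W0.
  by move=> g' i'; exact: (tmax (g', i')).
exists y; split => // j; apply: le_trans (yB j) _.
have Y0 : 0 <= E ^+ 2 * (1 + W) by rewrite mulr_ge0 ?exprn_ge0 ?addr_ge0.
have hb := hessian_entry_bound g i (le_trans pyx px) Y0 yB.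
apply: (quadratic_self_bound (h := `|(hessian p (grid g) *m (y - grid g)) i 0|)) => //.
  by rewrite -normrX ger0_norm // sqr_ge0.
(* [x] and [y] share their Hessian images, so [W], attained at [(g, i)], can be computed from [y]
   and split at the grid point. *)
rewrite /W /h /= -Hyx.
have -> : hessian p (grid g) *m y =
    hessian p (grid g) *m (y - grid g) + hessian p (grid g) *m grid g.
  by rewrite mulmxBr subrK.
rewrite mxE; apply: le_trans (ler_normD _ _) _.
by rewrite lerD2l HzE.
Qed.

Lemma exists_small_point (x : 'cV[R]_n) :
  P x -> exists2 y : 'cV[R]_n, P y &
    forall j, `|y j 0| <= (n ^ 2 * n`!)%:R * B ^+ n * E.
Proof.
move=> Px.
have [||||||y [y1 _ y3]] := @exists_small_feasible_fin R 'I_m n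
    (fun i => DA *: row i A) (fun i => DA * b i 0) 0 x B E B_ge1 => //.
- by move=> i j; rewrite !mxE.
- by move=> i j; rewrite !mxE.
- by move=> i; rewrite scaled_row ler_pM2l.
- by move=> v _; rewrite mul0mx mxE.
by exists y => // i; have := y1 i; rewrite scaled_row ler_pM2l.
Qed.

End ShrinkingSublevelPoints.

(** * Bit lengths *)

Section BitLengths.
Variable R : archiRealFieldType.

Lemma absz_le_bl (k : int) : (`|k| <= 2 ^ bl_int k)%N.
Proof.
apply: leq_trans (_ : _ <= 2 ^ up_log 2 `|k|)%N _; first exact: up_logP.
by rewrite leq_exp2l // leq_maxr.
Qed.

Lemma denq_le_bl (r : rat) : (denq r)%:~R <= 2 ^+ bl_rat r :> R.
Proof.
have -> : (denq r)%:~R = `|denq r|%N%:R :> R by rewrite natr_absz gtr0_norm ?denq_gt0.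
rewrite -natrX ler_nat; apply: leq_trans (absz_le_bl _) _.
by rewrite leq_exp2l // leq_addl.
Qed.

Lemma norm_ratr_le_bl (r : rat) : `|ratr r : R| <= 2 ^+ bl_rat r.
Proof.
have d1 : 1 <= (denq r)%:~R :> R by rewrite ler1z -gtz0_ge1 denq_gt0.
rewrite /ratr normrM normfV [X in _ / X]ger0_norm; last by apply: le_trans d1.
rewrite ler_pdivrMr; last by apply: lt_le_trans d1.
apply: le_trans (_ : _ <= 2 ^+ bl_rat r * 1) _; last by rewrite ler_wpM2l // exprn_ge0.
rewrite mulr1 -intr_norm -natr_absz -natrX ler_nat.
by apply: leq_trans (absz_le_bl _) _; rewrite leq_exp2l // leq_addr.
Qed.

(** [D] is the product of the denominators; bit lengths add up under this product. *)
Lemma common_denominator (I : eqType) (s : seq I) (a : I -> rat) :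
  exists D : R, [/\ D \is a Num.int, 1 <= D, D <= 2 ^+ (\sum_(i <- s) bl_rat (a i))%N &
    forall i, i \in s -> D * ratr (a i) \is a Num.int].
Proof.
elim: s => [|i s [D [Dint D1 D2 Da]]].
  by exists 1; split; rewrite ?rpred1 // big_nil expr0.
have di : ((denq (a i))%:~R : R) \is a Num.int by exact: intr_int.
have d1 : 1 <= (denq (a i))%:~R :> R by rewrite ler1z -gtz0_ge1 denq_gt0.
have D0 : 0 <= D by apply: le_trans D1.
have d0 : 0 <= (denq (a i))%:~R :> R by apply: le_trans d1.
exists ((denq (a i))%:~R * D); split.
- by rewrite rpredM.
- by rewrite mulr_ege1.
- by rewrite big_cons exprD ler_pM // denq_le_bl.
move=> j; rewrite inE => /orP[/eqP ->|js]; last by rewrite -mulrA rpredM ?Da.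
rewrite mulrAC rpredM // /ratr mulrC divfK ?intr_int //.
by rewrite gt_eqF // (lt_le_trans _ d1).
Qed.

Lemma factorial_le_exp (n m : nat) : (n <= m)%N -> (n`! <= m ^ n)%N.
Proof.
elim: n => // n IH nm; rewrite factS expnS leq_mul //; exact: IH (ltnW nm).
Qed.

Lemma norm_le_exp2M (a b : R) (i j : nat) :
  `|a| <= 2 ^+ i -> `|b| <= 2 ^+ j -> `|a * b| <= 2 ^+ (i + j).
Proof. by move=> ai bj; rewrite normrM exprD ler_pM. Qed.

Lemma norm_le_exp2X (a : R) (i k : nat) : `|a| <= 2 ^+ i -> `|a ^+ k| <= 2 ^+ (i * k).
Proof. by move=> ai; rewrite normrX exprM lerXn2r ?nnegrE ?exprn_ge0. Qed.

Lemma norm_nat_le_exp2 (k N : nat) : (k <= N)%N -> `|k%:R : R| <= 2 ^+ N.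
Proof.
move=> kN; rewrite normr_nat -natrX ler_nat; apply: leq_trans kN _.
exact/ltnW/ltn_expl.
Qed.

Lemma norm_sum_le_exp2 (k N e : nat) (a : 'I_k -> R) :
  (k <= N)%N -> (forall i, `|a i| <= 2 ^+ e) -> `|\sum_i a i| <= 2 ^+ (N + e).
Proof.
move=> kN ae; apply: le_trans (ler_norm_sum _ _ _) _.
apply: le_trans (_ : _ <= \sum_(i < k) 2 ^+ e) _; first exact: ler_sum.
rewrite sumr_const card_ord -(mulr_natl (2 ^+ e)) exprD ler_wpM2r ?exprn_ge0 //.
by have := norm_nat_le_exp2 kN; rewrite normr_nat.
Qed.

Lemma exp2_leW (a : R) (i j : nat) : `|a| <= 2 ^+ i -> (i <= j)%N -> `|a| <= 2 ^+ j.
Proof. by move=> ai ij; apply: le_trans ai _; apply: ler_weXn2l; rewrite ?ler1n. Qed.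

End BitLengths.

(** Exponents are compared by treating [N ^ 2], [N ^ 3] and [N ^ 4] as unknowns related by
    [10 * N ^ k <= N ^ k.+1], which leaves a linear problem. *)
Ltac exponents := match goal with
  | sq1 : is_true (10 * ?N <= ?N ^ 2)%N, sq2 : is_true (10 * ?N ^ 2 <= ?N ^ 3)%N,
    sq3 : is_true (10 * ?N ^ 3 <= ?N ^ 4)%N, N10 : is_true (9 < ?N)%N,
    e3 : (?N ^ 2 * ?N = ?N ^ 3)%N, e4 : (?N ^ 3 * ?N = ?N ^ 4)%N |- _ =>
    rewrite ?mulnn -?(mulnA _ (N ^ 2)%N N) -?(mulnA _ (N ^ 3)%N N) ?e3 ?e4;
    move: sq1 sq2 sq3 N10; clear;
    move: (N ^ 2)%N (N ^ 3)%N (N ^ 4)%N => *; lia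
  end.

Lemma exists_exp_bounded_lower_point (R : archiRealFieldType) (n m N : nat)
    (p : {mpoly R[n]}) (A : 'M[R]_(m, n)) (b : 'cV[R]_m) (DA Df lb : R)
    (P := fun x : 'cV[R]_n => forall i, (A *m x) i 0 <= b i 0) :
  (0 < n)%N -> (n <= N)%N -> (10 <= N)%N ->
  mconvex p -> (size (msupp p) <= N)%N -> (msize p <= N.+1)%N ->
  (forall mm, `|p@_mm| <= 2 ^+ N) -> 1 <= Df -> Df <= 2 ^+ N ->
  (forall mm, Df * p@_mm \is a Num.int) ->
  1 <= DA -> DA <= 2 ^+ N -> (forall i j, DA * A i j \is a Num.int) ->
  (forall i j, `|A i j| <= 2 ^+ N) -> (forall i, `|b i 0| <= 2 ^+ N) ->
  (forall x, P x -> lb <= mev p x) ->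
  forall x, P x -> exists y : 'cV[R]_n,
    [/\ P y, mev p y <= mev p x & forall j, `|y j 0| <= 2 ^+ (40 * N ^ 4)].
Proof.
move=> n0 nN N10 pc sN dN pC Df1 DfN pint DA1 DAN Aint AN bN p_lb x Px.
(* [B] has to cover the scaled Hessian entries, of exponent [5 N + N^2]. The largest demand on [E]
   is the value of [p] at the small point [x0], of exponent [2 N + 4 N^4]. *)
pose E : R := 2 ^+ (5 * N ^ 4); pose B : R := 2 ^+ (2 * N ^ 2).
pose grid (g : {ffun 'I_n -> 'I_N.+1}) : 'cV[R]_n := \col_i (g i)%:R.
have N0 : (0 < N)%N by apply: leq_trans N10.
have le2 (a : R) (e f : nat) : `|a| <= 2 ^+ e -> (e <= f)%N -> a <= 2 ^+ f.
  by move=> ae ef; apply: le_trans (ler_norm _) (exp2_leW ae ef).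
have sq1 : (10 * N <= N ^ 2)%N by rewrite (expnD _ 1 1) leq_mul.
have sq2 : (10 * N ^ 2 <= N ^ 3)%N by rewrite (expnD _ 1 2) leq_mul.
have sq3 : (10 * N ^ 3 <= N ^ 4)%N by rewrite (expnD _ 1 3) leq_mul.
have e3 : (N ^ 2 * N = N ^ 3)%N by rewrite -expnSr.
have e4 : (N ^ 3 * N = N ^ 4)%N by rewrite -expnSr.
have NR k : (k <= N)%N -> `|k%:R : R| <= 2 ^+ N := @norm_nat_le_exp2 R k N.
have DfB : `|Df| <= 2 ^+ N by rewrite ger0_norm // (le_trans _ Df1).
have DAB : `|DA| <= 2 ^+ N by rewrite ger0_norm // (le_trans _ DA1).
have C0 : (0 : R) <= 2 ^+ N by rewrite exprn_ge0.
have X1 : (1 : R) <= N%:R by rewrite ler1n.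
have gridX g i : `|grid g i 0| <= N%:R by rewrite mxE normr_nat ler_nat -ltnS.
have NN : `|(N%:R : R) ^+ N| <= 2 ^+ (N * N) by apply: norm_le_exp2X; exact: NR.
have pos2 (e : nat) : `|2 ^+ e : R| <= 2 ^+ e by rewrite ger0_norm // exprn_ge0.
have HN g i j : `|hessian p (grid g) i j| <= 2 ^+ (4 * N + N ^ 2).
  have := norm_hessian_le sN dN C0 pC X1 (gridX g) i j => /le_trans; apply.
  apply: (@le2 _ (N + (N + N + N) + N * N)%N); last by exponents.
  by do ![apply: norm_le_exp2M] => //; exact: NR.
have GN g i : `|gradient p (grid g) 0 i| <= 2 ^+ (4 * N + N ^ 2).
  have := norm_gradient_le sN dN C0 pC X1 (gridX g) i => /le_trans; apply.
  apply: (@le2 _ (N + (N + N) + N * N)%N); last by exponents.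
  by do ![apply: norm_le_exp2M] => //; exact: NR.
have KB : `|(n ^ 2 * n`!)%:R * B ^+ n| <= 2 ^+ (3 * N ^ 3).
  apply: (@exp2_leW _ _ ((N + N) + N * N + 2 * N ^ 2 * N)); last first.
    by exponents.
  apply: norm_le_exp2M; last first.
    apply: (@exp2_leW _ _ (2 * N ^ 2 * n)); last by rewrite leq_mul2l nN orbT.
    by apply: norm_le_exp2X; exact: pos2.
  rewrite natrM; apply: norm_le_exp2M.
    by rewrite natrX expr2; apply: norm_le_exp2M; exact: NR.
  rewrite normr_nat; apply: le_trans (_ : (N ^ N)%:R <= _); last first.
    by rewrite natrX; apply: le_trans (ler_norm _) NN.
  rewrite ler_nat; apply: leq_trans (factorial_le_exp nN) _.
  by rewrite leq_pexp2l.
have B1 : 1 <= B by rewrite exprn_ege1 // ler1n.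
have AB i j : `|DA * A i j| <= B.
  by apply: exp2_leW (norm_le_exp2M DAB (AN i j)) _; exponents.
have bB i : `|DA * b i 0| <= 2 ^+ (N + N) by apply: norm_le_exp2M.
have ge8 : (8 : R) <= 2 ^+ (N + N).
  by rewrite (_ : 8 = 2 ^+ 3) ?ler_weXn2l ?ler1n -?natrX //; exponents.
(* The role of [E] is played here by [2 ^+ (N + N)], so that the size of [x0] does not depend on the
   actual [E], which must dominate [p(x0)]. *)
have [x0 Px0 x0B] := exists_small_point ge8 B1 DA1 Aint AB bB Px.
have px0 : mev p x0 <= E.
  pose X0 : R := 2 ^+ (4 * N ^ 3).
  have X01 : 1 <= X0 by rewrite exprn_ege1 // ler1n.
  have x0X i : `|x0 i 0| <= X0.
    apply: le_trans (x0B i) _.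
    by apply: le2 (norm_le_exp2M KB (pos2 _)) _; exponents.
  apply: le_trans (ler_norm _) _.
  have := norm_mev_le sN dN C0 pC X01 x0X => /le_trans; apply.
  rewrite /E; apply: (@le2 _ (N + N + 4 * N ^ 3 * N)%N); last first.
    by exponents.
  do ![apply: norm_le_exp2M] => //; first exact: NR.
  by apply: norm_le_exp2X; exact: pos2.
(* Above the level [E], the point [x0] is itself lower than [x]. *)
have [pxE|/ltW Epx] := lerP (mev p x) E; last first.
  exists x0; split => //; first exact: le_trans px0 Epx.
  move=> j; apply: le_trans (x0B j) _.
  by apply: le2 (norm_le_exp2M KB (pos2 _)) _; exponents.
have E40 : 2 ^+ (40 * N ^ 4) = E ^+ 8 by rewrite -exprM mulnAC.
rewrite E40.
apply: (@exists_bounded_lower_point R n m N p A b DA Df B E lb) => //; rewrite ?/E.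
- by apply: le_trans ge8 _; apply: ler_weXn2l; rewrite ?ler1n //; exponents.
- by apply: le_trans DfN _; apply: ler_weXn2l; rewrite ?ler1n //; exponents.
- by move=> i; apply: exp2_leW (bB i) _; exponents.
- move=> g i j; apply: int_hessian => // k; by rewrite mxE natr_int.
- by move=> g i j; apply: exp2_leW (norm_le_exp2M DfB (HN g i j)) _; exponents.
- by move=> g i j; apply: exp2_leW (HN g i j) _; exponents.
- move=> g i; rewrite mxE; apply: (@exp2_leW _ _ (N + (4 * N + N ^ 2 + N))); last by exponents.
  apply: norm_sum_le_exp2 => // j; apply: norm_le_exp2M; first exact: HN.
  by rewrite mxE; apply: NR; rewrite -ltnS.
- by apply: le2 KB _; exponents.
- apply: (@le2 _ (1 + (N + N))%N); last by exponents.
  rewrite natrM natrM natrX; do ![apply: norm_le_exp2M] => //; last exact: NR.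
  by rewrite normr_nat expr1.
- by apply: le2 (NR N (leqnn _)) _; exponents.
- move=> g; have := norm_mev_le sN dN C0 pC X1 (gridX g) => /le_trans; apply.
  apply: (@le2 _ (N + N + N * N)%N); last by exponents.
  by do ![apply: norm_le_exp2M] => //; exact: NR.
- move=> g; apply: (@le2 _ (N + (4 * N + N ^ 2))%N); last by exponents.
  by apply: norm_sum_le_exp2 => // j; rewrite normr_id; exact: GN.
Qed.

(** * Logarithms, norms and the final bound *)

Lemma exp2_le_exp (k : nat) : 2 ^+ k <= Rtrigo_def.exp k%:R.
Proof.
have e1 : 2 <= Rtrigo_def.exp 1.
  have -> : 2 = Rdefinitions.Rplus 1 1 by rewrite RplusE.
  by apply/RleP; exact: Rpower.exp_ineq1_le.
elim: k => [|k IH]; first by rewrite expr0 Rtrigo_def.exp_0.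
have -> : Rtrigo_def.exp k.+1%:R = Rtrigo_def.exp k%:R * Rtrigo_def.exp 1.
  by rewrite -natr1 -RplusE Exp_prop.exp_plus.
by rewrite exprSr ler_pM // exprn_ge0.
Qed.

Lemma Rln_le_exp2 (x : Rdefinitions.R) (k : nat) :
  0 <= x -> x <= 2 ^+ k -> Rln x <= k%:R.
Proof.
move=> x0 xk; have [x_gt0|x_le0] := ltrP 0 x.
  rewrite leNgt; apply/negP; rewrite /Rln -{1}(Rpower.ln_exp k%:R) => /RltP H.
  move: x_gt0 => /RltP x_gt0.
  have /RltP := Rpower.ln_lt_inv _ _ (Exp_prop.exp_pos _) x_gt0 H.
  by rewrite ltNge (le_trans xk (exp2_le_exp k)).
(* At 0 the logarithm takes its default value 0. *)
have -> : x = 0 by apply/eqP; rewrite eq_le x_le0.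
rewrite /Rln /Rpower.ln; case: RIneq.Rlt_dec => [H|_]; last exact: ler0n.
by exfalso; exact: (RIneq.Rlt_irrefl _ H).
Qed.

Lemma sqrt_sum_sqr_le_exp2 (R : rcfType) (n k : nat) (x : 'cV[R]_n) :
  (n <= 2 ^ k)%N -> (forall j, `|x j 0| <= 2 ^+ k) ->
  Num.sqrt (\sum_(i < n) x i 0 ^+ 2) <= 2 ^+ (2 * k).
Proof.
move=> nk xk; have p0 (e : nat) : 0 <= (2 : R) ^+ e by rewrite exprn_ge0.
rewrite -[leRHS](ger0_norm (p0 _)) -sqrtr_sqr; apply: ler_wsqrtr.
apply: le_trans (_ : _ <= \sum_(i < n) (2 : R) ^+ (2 * k)) _.
  apply: ler_sum => i _; rewrite -real_normK ?num_real // mulnC exprM.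
  by rewrite lerXn2r ?nnegrE.
rewrite sumr_const card_ord -(mulr_natl (2 ^+ _)) expr2 ler_wpM2r //.
apply: le_trans (_ : (2 ^ k)%:R <= _); first by rewrite ler_nat.
by rewrite natrX ler_weXn2l ?ler1n // leq_pmull.
Qed.

Lemma bl_rat_gt0 (r : rat) : (0 < bl_rat r)%N.
Proof. by rewrite addn_gt0 leq_max. Qed.

Lemma leq_bigsum (I : eqType) (s : seq I) (F : I -> nat) i :
  i \in s -> (F i <= \sum_(j <- s) F j)%N.
Proof. by move=> si; rewrite (big_rem i) //= leq_addr. Qed.

Lemma bl_mxE (m n : nat) (A : 'M[rat]_(m, n)) :
  bl_mx A = (\sum_(ij : 'I_m * 'I_n) bl_rat (A ij.1 ij.2))%N.
Proof. by rewrite /bl_mx pair_bigA. Qed.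

Theorem theorem1p1 :
  exists p : {mpoly Rdefinitions.R[2]},
  forall (n m : nat) (f : {mpoly rat[n]}) (A : 'M[rat]_(m, n)) (b : 'cV[rat]_m),
    (0 < n)%N ->
    convex_mpoly f ->
    (exists x : 'cV[Rdefinitions.R]_n, in_polyhedron A b x) ->
    (forall M : Rdefinitions.R, exists x : 'cV[Rdefinitions.R]_n, in_polyhedron A b x /\ feval f x < M)
    \/
    (exists xs : 'cV[Rdefinitions.R]_n,
        in_polyhedron A b xs /\
        (forall x : 'cV[Rdefinitions.R]_n, in_polyhedron A b x -> feval f xs <= feval f x) /\
        Rln (eucl_norm xs) <= eval2 p (enc_poly f)%:R (enc_poly_hedron A b)%:R).
Proof.
(* Coordinates are bounded by [2 ^+ (40 * N ^ 4)]; passing to the Euclidean norm at most doubles the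
   exponent, whence 80. *)
exists (80%:R%:MP * ('X_ord0 + 'X_(lift ord0 ord0) + 10%:R%:MP) ^+ 4).
move=> n m f A b n0 fc [x1 Px1].
have [unb|bnd] := Classical_Prop.classic (forall M : Rdefinitions.R,
  exists x : 'cV[Rdefinitions.R]_n, in_polyhedron A b x /\ feval f x < M); [by left|right].
have [lb f_lb] : exists lb : Rdefinitions.R, forall x : 'cV[Rdefinitions.R]_n,
    in_polyhedron A b x -> lb <= feval f x.
  apply: Classical_Prop.NNPP => H; apply: bnd => M; apply: Classical_Prop.NNPP => H'.
  apply: H; exists M => x Px; rewrite leNgt; apply/negP => fx.
  by apply: H'; exists x.
pose N := (enc_poly f + enc_poly_hedron A b + 10)%N.
pose p := map_mpoly (ratr : rat -> Rdefinitions.R) f.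
pose A' : 'M[Rdefinitions.R]_(m, n) := map_mx ratr A.
pose b' : 'cV[Rdefinitions.R]_m := map_mx ratr b.
have PE x : in_polyhedron A b x <-> forall i, (A' *m x) i 0 <= b' i 0.
  by split => H i; have := H i; rewrite [b' i 0]mxE.
have fN : (\sum_(mm <- msupp f) bl_rat f@_mm <= N)%N by rewrite /N /enc_poly; lia.
have PN : (bl_mx A + bl_mx b <= N)%N.
  by have := leq_maxr n (bl_mx A + bl_mx b)%N; rewrite /N /enc_poly_hedron; lia.
have supp : perm_eq (msupp p) (msupp f).
  by apply: msupp_map_mpoly; exact: fmorph_inj.
have szN : (size (msupp p) <= N)%N.
  rewrite (perm_size supp); apply: leq_trans fN.
  (* Each nonzero coefficient contributes at least 1 to the encoding length, which therefore bounds
     the number of monomials. *)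
  rewrite -sum1_size; apply: leq_sum => mm _; exact: bl_rat_gt0.
have dN : (msize p <= N.+1)%N.
  have -> : msize p = msize f by rewrite !msizeE (perm_big _ supp).
  by rewrite /N /enc_poly /mpoly_deg; lia.
have pC mm : `|p@_mm| <= 2 ^+ N.
  rewrite mcoeff_map_mpoly; have [mf|mf] := boolP (mm \in msupp f).
    apply: exp2_leW (norm_ratr_le_bl _ _) _.
    exact: leq_trans (leq_bigsum (fun mm => bl_rat f@_mm) mf) fN.
  by rewrite memN_msupp_eq0 // raddf0 normr0 exprn_ge0.
have [Df [_ Df1 Df2 Dfint]] :=
  common_denominator Rdefinitions.R (msupp f) (fun mm => f@_mm).
have [DA [_ DA1 DA2 DAint]] :=
  common_denominator Rdefinitions.R (index_enum ('I_m * 'I_n)%type) (fun ij => A ij.1 ij.2).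
have AN i j : (bl_rat (A i j) <= N)%N.
  apply: leq_trans (leq_bigsum (fun ij : 'I_m * 'I_n => bl_rat (A ij.1 ij.2))
    (mem_index_enum (i, j))) _.
  by rewrite -bl_mxE; apply: leq_trans PN; exact: leq_addr.
have bN i : (bl_rat (b i ord0) <= N)%N.
  apply: leq_trans (leq_bigsum (fun ij : 'I_m * 'I_1 => bl_rat (b ij.1 ij.2))
    (mem_index_enum (i, ord0))) _.
  by rewrite -bl_mxE; apply: leq_trans PN; exact: leq_addl.
have exp2_le (i j : nat) : (i <= j)%N -> 2 ^+ i <= 2 ^+ j :> Rdefinitions.R.
  by move=> ij; apply: ler_weXn2l => //; rewrite ler1n.
have nN : (n <= N)%N by rewrite /N /enc_poly; lia.
have N10 : (10 <= N)%N by rewrite /N; lia.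
have DfN : Df <= 2 ^+ N by apply: le_trans Df2 _; exact: exp2_le.
have DAN : DA <= 2 ^+ N.
  apply: le_trans DA2 _; apply: exp2_le; rewrite -bl_mxE.
  by apply: leq_trans PN; exact: leq_addr.
have pint mm : Df * p@_mm \is a Num.int.
  rewrite mcoeff_map_mpoly; have [mf|mf] := boolP (mm \in msupp f); first exact: Dfint.
  by rewrite memN_msupp_eq0 // raddf0 mulr0 rpred0.
have Aint i j : DA * A' i j \is a Num.int.
  by rewrite mxE; exact: (DAint (i, j) (mem_index_enum _)).
have A'N i j : `|A' i j| <= 2 ^+ N.
  by rewrite mxE; apply: exp2_leW (norm_ratr_le_bl _ _) (AN i j).
have b'N i : `|b' i 0| <= 2 ^+ N.
  by rewrite mxE; apply: exp2_leW (norm_ratr_le_bl _ _) (bN i).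
have p_lb x : (forall i, (A' *m x) i 0 <= b' i 0) -> lb <= mev p x.
  by move=> /PE /f_lb.
have low x : in_polyhedron A b x -> exists y : 'cV[Rdefinitions.R]_n,
    [/\ forall i, (A' *m y) i 0 <= b' i 0, feval f y <= feval f x &
        forall j, `|y j 0| <= 2 ^+ (40 * N ^ 4)].
  move=> /PE Px; exact: (@exists_exp_bounded_lower_point _ n m N p A' b' DA Df lb
    n0 nN N10 fc szN dN pC Df1 DfN pint DA1 DAN Aint A'N b'N p_lb x Px).
(* A minimiser over the box is one over the whole polyhedron, since [low] moves any feasible point
   into the box without increasing [f]. *)
have [|xs [xsP xsB] xsmin] := @Attainment.exists_min_on_box _ n m _ (msupp p)
    (fun mm => p@_mm) (fun mm i => mm i) A' b' (2 ^+ (40 * N ^ 4)).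
  by have [y [y1 _ y3]] := low x1 Px1; exists y.
exists xs; split; first exact/PE.
split=> [x /low [y [y1 y2 y3]]|].
  apply: le_trans y2; have := xsmin y (conj y1 y3).
  by rewrite -!mevalE.
have -> : eval2 (80%:R%:MP * ('X_ord0 + 'X_(lift ord0 ord0) + 10%:R%:MP) ^+ 4)
    (enc_poly f)%:R (enc_poly_hedron A b)%:R = (2 * (40 * N ^ 4))%:R.
  rewrite /eval2 mevalM mevalC rmorphXn /= !mevalD mevalC !mevalXU /=.
  by rewrite mulnA natrM natrX /N !natrD.
apply: Rln_le_exp2; first exact: sqrtr_ge0.
apply: sqrt_sum_sqr_le_exp2 => //.
apply: leq_trans nN _; apply: leq_trans (ltnW (ltn_expl N (leqnn 2))) _.
by rewrite leq_exp2l // (expnS N 3) mulnCA leq_pmulr // muln_gt0 expn_gt0; lia.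
Qed.
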